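(* Let $T\subset[0,\infty)$ be locally finite, and put $N_T(R)=\#(T\cap[0,R])$ and $F_T(r)=(1-r^2)\sum_{t\in T}r^{2t}$ for $0<r<1$. (1) If $T\in\mathfrak U$, then $0\in T$ and there exist constants $0<c_T\le C_T<\infty$ such that $$c_T\le F_T(r)\le C_T,\qquad 0<r<1.\qquad( * )$$ (2) If $T$ is a locally finite subset of $[0,\infty)$ containing $0$, then $( * )$ (for some constants $0<c_T\le C_T<\infty$) is equivalent to the existence of constants $0<c_T'\le C_T'<\infty$ and $R_0>0$ such that $$c_T'R\le N_T(R)\le C_T'R,\qquad R\ge R_0.$$
   Context: $\mathbb N=\{0,1,2,\dots\}$. A set $T\subset[0,\infty)$ is locally finite if $T\cap[0,R]$ is finite for every $R>0$. For a positive operator $A$ on a Hilbert space, $A^t$ is defined by continuous functional calculus for $t>0$ and $A^0=I$. The family $\{CA^t\}_{t\in T}$ is exactly observable if there are $0<a\le b<\infty$ with $a\|x\|^2\le\sum_{t\in T}\|CA^tx\|^2\le b\|x\|^2$ for all $x\in H$. $\mathfrak U$ is the class of universal time sets: locally finite $T\subset[0,\infty)$ such that for all separable complex Hilbert spaces $H,Y$, every positive $A\in\mathcal B(H)$ and every $C\in\mathcal B(H,Y)$, exact observability of $\{CA^n\}_{n\in\mathbb N}$ implies exact observability of $\{CA^t\}_{t\in T}$. *)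

(* Defs.v *)
From HB Require Import structures.
From mathcomp Require Import all_boot all_order all_algebra finmap.
From mathcomp Require Import sesquilinear complex.
From mathcomp Require Import all_classical all_reals all_analysis.

Set Implicit Arguments.
Unset Strict Implicit.
Unset Printing Implicit Defensive.
Import Order.TTheory GRing.Theory Num.Theory.
Import numFieldNormedType.Exports.

Local Open Scope classical_set_scope.
Local Open Scope ring_scope.
Local Open Scope complex_scope.

(* The inner product is linear in the first argument and conjugate-linear in
   the second; norms of a normedModType R[i] take their values in R[i]. *)
Record hilbert (R : realType) := Hilbert {
  hilbert_sort :> completeNormedModType R[i] ;
  inner : {dot hilbert_sort for @Num.conj R[i]} ;
  innerE : forall x : hilbert_sort, inner x x = `|x| ^+ 2 }.

Section Hilbert.
Context {R : realType}.

Definition separable (H : hilbert R) : Prop :=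
  exists2 D : set H, countable D & dense D.

Definition normsq (V : normedModType R[i]) (x : V) : R :=
  complex.Re (`|x| ^+ 2).

(* For bounded linear maps, continuity and boundedness are the same thing
   (linear_bounded_continuous); B(H, Y) consists of the continuous
   {linear H -> Y}. The order of R[i] makes 0 <= z entail that z is real. *)
Definition positive_op (H : hilbert R) (A : {linear H -> H}) : Prop :=
  forall x : H, 0 <= inner H (A x) x.

Definition spectrum (H : hilbert R) (A : {linear H -> H}) : set R[i] :=
  [set z | ~ exists B : {linear H -> H},
     [/\ continuous (B : H -> H),
         forall x, B (A x - z *: x) = x
       & forall x, A (B x) - z *: B x = x] ].

(* C(spectrum A); an element is represented by any function on R[i] whose
   restriction to the spectrum it is. *)
Definition continuous_on_spectrum (H : hilbert R) (A : {linear H -> H})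
    (f : R[i] -> R[i]) : Prop :=
  {within (spectrum A : set R[i]^o), continuous (f : R[i]^o -> R[i]^o)}.

(* Phi is a unital *-homomorphism from C(spectrum A) to B(H) which sends the
   identity function to A. For A self-adjoint there is exactly one (on
   C(spectrum A)); its continuity is automatic. *)
Record is_functional_calculus (H : hilbert R) (A : {linear H -> H})
    (Phi : (R[i] -> R[i]) -> H -> H) : Prop := IsFunctionalCalculus {
  fcalc_linear : forall f, continuous_on_spectrum A f -> linear (Phi f) ;
  fcalc_continuous : forall f, continuous_on_spectrum A f ->
    continuous (Phi f) ;
  fcalc_ext : forall f g,
    continuous_on_spectrum A f -> continuous_on_spectrum A g ->
    {in spectrum A, f =1 g} -> Phi f = Phi g ;
  fcalc1 : Phi (cst 1) = id ;
  fcalc_id : Phi id = A ;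
  fcalcD : forall f g,
    continuous_on_spectrum A f -> continuous_on_spectrum A g ->
    forall x, Phi (f \+ g) x = Phi f x + Phi g x ;
  fcalcZ : forall (c : R[i]) f, continuous_on_spectrum A f ->
    forall x, Phi (fun z => c * f z) x = c *: Phi f x ;
  fcalcM : forall f g,
    continuous_on_spectrum A f -> continuous_on_spectrum A g ->
    forall x, Phi (f \* g) x = Phi f (Phi g x) ;
  fcalc_adjoint : forall f, continuous_on_spectrum A f ->
    forall x y, inner H (Phi f x) y = inner H x (Phi (fun z => (f z)^*) y) }.

Definition functional_calculus (H : hilbert R) (A : {linear H -> H}) :
    (R[i] -> R[i]) -> H -> H :=
  xget ((fun=> id) : (R[i] -> R[i]) -> H -> H)
    [set Phi | is_functional_calculus A Phi].

(* The spectrum of a positive operator lies in [0, +oo), where the function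
   below is z |-> z ^ t; note that 0 `^ t = 0 for t != 0. *)
Definition oppow (H : hilbert R) (A : {linear H -> H}) (t : R) : H -> H :=
  if t == 0 then id
  else functional_calculus A (fun z => (complex.Re z `^ t)%:C).

Definition exactly_observable (H Y : hilbert R)
    (C : {linear H -> Y}) (A : {linear H -> H}) (T : set R) : Prop :=
  exists a b : R, [/\ 0 < a, a <= b & forall x : H,
    ((a * normsq x)%:E <= \esum_(t in T) (normsq (C (oppow A t x)))%:E
       <= (b * normsq x)%:E)%E].

Definition locally_finite (T : set R) : Prop :=
  forall r : R, 0 < r -> finite_set (T `&` `[0, r]).

Definition universal_time_set (T : set R) : Prop :=
  [/\ T `<=` [set t | 0 <= t], locally_finite T
    & forall (H Y : hilbert R) (A : {linear H -> H}) (C : {linear H -> Y}),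
        separable H -> separable Y ->
        continuous (A : H -> H) -> positive_op A -> continuous (C : H -> Y) ->
        exactly_observable C A [set n%:R | n in [set: nat]] ->
        exactly_observable C A T].

(* Meaningful for locally finite T: fset_set is empty on infinite sets. *)
Definition counting_fun (T : set R) (x : R) : nat :=
  #|` fset_set (T `&` `[0, x]) |.

Definition F_ (T : set R) (r : R) : \bar R :=
  ((1 - r ^+ 2)%:E * \esum_(t in T) (r `^ (2 * t))%:E)%E.

Definition F_bounded (T : set R) : Prop :=
  exists c C : R, [/\ 0 < c, c <= C &
    forall r, 0 < r < 1 -> (c%:E <= F_ T r <= C%:E)%E].

Definition linear_growth (T : set R) : Prop :=
  exists c C x0 : R, [/\ 0 < c, c <= C, 0 < x0 &
    forall x, x0 <= x -> c * x <= (counting_fun T x)%:R <= C * x].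

End Hilbert.

(* Main.v *)
Require Import Defs.
From HB Require Import structures.
From mathcomp Require Import all_boot all_order all_algebra finmap.
From mathcomp Require Import sesquilinear complex.
From mathcomp Require Import all_classical all_reals all_analysis.
From mathcomp Require Import ring lra.

(* (1) Let A be the diagonal operator on l^2(N, C) with entries r_k in [0, 1),
   and C the diagonal operator with entries (1 - r_k^2)^(1/2). The geometric
   series gives \sum_n |C A^n x|^2 = |x|^2, so (C, A) is exactly observable along
   N, whereas \sum_(t in T) |C A^t e_k|^2 = F_T(r_k). If T is universal, F_T(r_k)
   is thus bounded above and away from 0 uniformly in k; taking r_k with F_T(r_k)
   outside [1/(k+1), k+1] is contradictory, and r_k = 0 forces 0 in T. To compute
   A^t, note that at an eigenvalue l > 0 the difference quotient of z |-> z^t is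
   continuous, so Phi(z^t) - l^t = Phi(h) (A - l) kills the eigenvector.

   (2) With r^2 = e^(-s), F_T(r) is (1 - e^(-s)) times the Laplace sum
   S(s) = \sum_(t in T) e^(-s t), and the equivalence is a Tauberian argument:
   S(s) >= e^(-s x) N(x) bounds N above, S(s) <= N(x) + e^(-s x / 2) S(s / 2) with
   s x large bounds N below, and conversely S is summed in layers of length 1/s. *)

Set Implicit Arguments.
Unset Strict Implicit.
Unset Printing Implicit Defensive.
Import Order.TTheory GRing.Theory Num.Theory.
Import numFieldNormedType.Exports.

Local Open Scope classical_set_scope.
Local Open Scope ring_scope.

(** * Laplace sums and the counting function *)

Section LaplaceSum.
Context {R : realType}.
Implicit Types (T : set R) (s x : R).

Definition laplace_sum T s : \bar R := \esum_(t in T) (expR (- (s * t)))%:E.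

Lemma fset_sum_le_esum (I : choiceType) (D : set I) (f : I -> R) (X : {fset I}) :
  [set` X] `<=` D -> ((\sum_(i <- X) f i)%:E <= \esum_(i in D) (f i)%:E)%E.
Proof.
move=> XD; apply: esum_ge; exists [set` X]; first by split.
by rewrite fsbig_finite//= set_fsetK sumEFin.
Qed.

(** [\esum] is a supremum over finite subsets, so upper bounds on Laplace sums reduce to estimates
    of finite sums. *)
Lemma esum_le_fset (I : choiceType) (D : set I) (f : I -> R) (M : R) :
  (\esum_(i in D) (f i)%:E <= M%:E)%E <->
  (forall X : {fset I}, [set` X] `<=` D -> \sum_(i <- X) f i <= M).
Proof.
split=> [le_M X XD|le_M].
  by rewrite -lee_fin; apply: le_trans le_M; exact: fset_sum_le_esum.
apply: ge_ereal_sup => _ [X [finX XD] <-].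
rewrite fsbig_finite//= sumEFin lee_fin; apply: le_M => i /=.
by rewrite in_fset_set// inE => /XD.
Qed.

Lemma F_laplace_sum T s :
  F_ T (expR (- (s / 2))) = ((1 - expR (- s))%:E * laplace_sum T s)%E.
Proof.
rewrite /F_ /laplace_sum; congr (_%:E * _)%E.
  by rewrite -expRM_natl; congr (1 - expR _); lra.
apply: eq_esum => t _; rewrite -expRM; congr (expR _)%:E; lra.
Qed.

Lemma oneBexpR_gt0 s : 0 < s -> 0 < 1 - expR (- s).
Proof. by move=> s0; rewrite subr_gt0 expR_lt1 oppr_lt0. Qed.

(** The map [s |-> expR (- (s / 2))] carries the positive reals onto the radii in [(0, 1)], and
    dividing by the positive factor [1 - expR (- s)] isolates the Laplace sum. *)
Lemma F_boundedP T : F_bounded T <->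
  exists c C : R, [/\ 0 < c, c <= C & forall s, 0 < s ->
    ((c / (1 - expR (- s)))%:E <= laplace_sum T s
       <= (C / (1 - expR (- s)))%:E)%E].
Proof.
have key (c C s : R) : 0 < s ->
  ((c / (1 - expR (- s)))%:E <= laplace_sum T s
       <= (C / (1 - expR (- s)))%:E)%E =
  (c%:E <= F_ T (expR (- (s / 2))) <= C%:E)%E.
  move=> /oneBexpR_gt0 s0; rewrite F_laplace_sum.
  by rewrite ![(_ / _)%R]mulrC !EFinM lee_pdivrMl// lee_pdivlMl.
split=> -[c [C [c0 cC FcC]]]; exists c, C; split => //.
  move=> s s0; rewrite key//; apply: FcC.
  by rewrite expR_gt0 expR_lt1 oppr_lt0 divr_gt0.
move=> r /andP[r0 r1].
have -> : r = expR (- ((- (2 * ln r)) / 2)).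
  by rewrite -[LHS]lnK ?posrE//; congr expR; lra.
by rewrite -key ?FcC// oppr_gt0 pmulr_rlt0// ln_lt0// r0 r1.
Qed.

Lemma itv0P T x t : (T `&` `[0, x]) t <-> T t /\ 0 <= t <= x.
Proof. by rewrite /setI /= in_itv. Qed.

Section Counting.
Variable T : set R.
Hypothesis T_ge0 : T `<=` [set t | 0 <= t].
Hypothesis T_lf : locally_finite T.

(** Local finiteness enters here: [fset_set] has the expected elements only for a finite set. *)
Lemma card_le_counting_fun x (X : {fset R}) : 0 < x ->
  [set` X] `<=` T `&` `[0, x] -> (#|` X | <= counting_fun T x)%N.
Proof.
move=> x0 XT; apply: fsubset_leq_card; apply/fsubsetP => t tX.
by rewrite in_fset_set ?inE; [exact: XT|exact: T_lf].
Qed.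

Lemma le_counting_fun x y : 0 < x -> x <= y ->
  (counting_fun T x <= counting_fun T y)%N.
Proof.
move=> x0 xy; apply: card_le_counting_fun; first exact: lt_le_trans xy.
move=> t /=; rewrite in_fset_set; last exact: T_lf.
rewrite inE => /itv0P[Tt /andP[t0 tx]]; apply/itv0P.
by rewrite t0 (le_trans tx).
Qed.

Lemma sum_le_counting_fun x (X : {fset R}) (f : R -> R) : 0 < x ->
  [set` X] `<=` T -> (forall t, 0 <= f t <= 1) ->
  \sum_(t <- X | t <= x) f t <= (counting_fun T x)%:R.
Proof.
move=> x0 XT f1; rewrite big_fset_condE/=.
apply: (@le_trans _ _ (#|` [fset t in X | t <= x]%fset|%:R)).
  rewrite cardfE -sum1_card natr_sum.
  rewrite [leRHS](_ : _ = \sum_(t <- [fset t in X | t <= x]%fset) 1).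
    by apply: ler_sum => t _; have /andP[_ ->] := f1 t.
  by rewrite [RHS]big_seq_fsetE.
rewrite ler_nat; apply: card_le_counting_fun => // t /=.
rewrite !inE /= => /andP[tX tx]; apply/itv0P; rewrite tx andbT.
by split; [exact: XT|exact/T_ge0/XT].
Qed.

(** Drop the times beyond [x]; each remaining one weighs at least [expR (- (s * x))]. *)
Lemma counting_fun_le_laplace_sum s x : 0 < s -> 0 < x ->
  (((counting_fun T x)%:R * expR (- (s * x)))%:E <= laplace_sum T s)%E.
Proof.
move=> s0 x0; have finT := T_lf x0.
apply: le_trans (fset_sum_le_esum (X := fset_set (T `&` `[0, x])) _ _); last first.
  by move=> t /=; rewrite in_fset_set ?inE// => -[].
rewrite lee_fin /counting_fun cardfE -sum1_card natr_sum mulr_suml.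
rewrite [leRHS]big_seq_fsetE/=; apply: ler_sum => t _.
rewrite mul1r ler_expR lerN2 ler_pM2l//.
have := valP t; rewrite in_fset_set// inE => /itv0P[_].
by case/andP.
Qed.

(* Where [t > x] the weight [expR (- s t)] is at most
   [expR (- s x / 2) * expR (- (s / 2) t)]. *)
Lemma laplace_sum_tail s x (M : R) : 0 < s -> 0 < x ->
  (laplace_sum T (s / 2) <= M%:E)%E ->
  (laplace_sum T s <= ((counting_fun T x)%:R + expR (- (s * x / 2)) * M)%:E)%E.
Proof.
move=> s0 x0 /esum_le_fset le_M; apply/esum_le_fset => X XT.
 rewrite (bigID (fun t => t <= x))/=; apply: lerD.
  (* [sum_le_counting_fun] wants values in [[0, 1]] at every real, while [expR (- (s * t))] exceeds
     1 for [t < 0]; truncating at 1 changes nothing on [X]. *)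
  rewrite big_seq_cond (eq_bigr (fun t => Num.min 1 (expR (- (s * t))))).
    rewrite -big_seq_cond; apply: sum_le_counting_fun => // t.
    by rewrite le_min ler01 expR_ge0 ge_min lexx.
  move=> t /andP[tX _]; apply/esym/min_idPr.
  by rewrite expR_le1 oppr_le0 mulr_ge0 ?(ltW s0)//; exact/T_ge0/XT.
apply: (@le_trans _ _
  (expR (- (s * x / 2)) * \sum_(t <- X) expR (- (s / 2 * t)))); last first.
  rewrite ler_pM2l ?expR_gt0//; exact: le_M.
rewrite mulr_sumr [leRHS](bigID (fun t => t <= x))/= -[leLHS]add0r lerD//.
  by apply: sumr_ge0 => t _; rewrite mulr_ge0// expR_ge0.
apply: ler_sum => t; rewrite -ltNge -expRD ler_expR => xt.
by have := ltr_pM2l s0 x t; rewrite xt => ?; nra.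
Qed.

(* Layer [k] consists of the [t] with [k <= s t < k + 1]. The bound in [layers]
   is [C] times the sum over [k < K] of [2 ^- k * ((k + 1) / s + b)]. *)
Lemma laplace_sum_le_linear s (C b : R) : 0 < s -> 0 < C -> 0 < b ->
  (forall x, 0 < x -> (counting_fun T x)%:R <= C * (x + b)) ->
  (laplace_sum T s <= (C * (4 / s + 2 * b))%:E)%E.
Proof.
move=> s0 C0 b0 le_C; apply/esum_le_fset => X XT.
have layers (K : nat) : \sum_(t <- X | s * t < K%:R) expR (- (s * t)) <=
    C * (4 / s + 2 * b - ((2 * K%:R + 4) / s + 2 * b) * 2^-1 ^+ K).
  elim: K => [|K IH].
    rewrite big_seq_cond big_pred0 ?mulr0 ?add0r ?expr0 ?mulr1 ?subrr ?mulr0//.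
    move=> t; apply/negP => /andP[/XT/T_ge0 /= t0].
    by rewrite ltNge mulr_ge0// ltW.
  rewrite (bigID (fun t => s * t < K%:R))/=.
  have -> : \sum_(t <- X | (s * t < K.+1%:R) && (s * t < K%:R)) expR (- (s * t)) =
      \sum_(t <- X | s * t < K%:R) expR (- (s * t)).
    apply: eq_bigl => t; rewrite andb_idl// => /lt_trans; apply.
    by rewrite ltr_nat.
  pose q : R := 2^-1 ^+ K.
  have q0 : 0 < q by rewrite exprn_gt0.
  (* On this layer [s * t >= K], so each weight is at most [expR (- K%:R)], hence at most [2 ^- K]
     because [expR 1 >= 1 + 1]. *)
  have layer : \sum_(t <- X | (s * t < K.+1%:R) && ~~ (s * t < K%:R)) expR (- (s * t))
      <= (counting_fun T (K.+1%:R / s))%:R * q.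
    apply: (@le_trans _ _ (\sum_(t <- X | t <= K.+1%:R / s) q)); last first.
      under eq_bigr do rewrite -[q]mul1r.
      rewrite -mulr_suml ler_pM2r//.
      by apply: sum_le_counting_fun => // [|t]; rewrite ?divr_gt0 ?ler01 ?lexx.
    rewrite big_mkcond [leRHS]big_mkcond/=; apply: ler_sum => t _.
    case: ifP => [/andP[tK]|_]; last by case: ifP => // _; exact: ltW.
    rewrite -leNgt => Kt; have -> : t <= K.+1%:R / s by rewrite ler_pdivlMr// mulrC ltW.
    apply: (@le_trans _ _ (expR (- K%:R))); first by rewrite ler_expR lerN2.
    rewrite -[- K%:R]mulrN1 expRM_natl lerXn2r ?nnegrE ?expR_ge0//.
    rewrite expRN lef_pV2 ?posrE ?expR_gt0//.
    by apply: le_trans (expR_ge1Dx _).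
  have := le_C (K.+1%:R / s); rewrite divr_gt0// => /(_ isT) le_K.
  have leq_K := ler_wpM2r (ltW q0) le_K.
  rewrite exprS -/q -(natr1 K) in IH layer leq_K *.
  have -> : C * (4 / s + 2 * b -
      ((2 * (K%:R + 1) + 4) / s + 2 * b) * (2^-1 * q)) =
    C * (4 / s + 2 * b - ((2 * K%:R + 4) / s + 2 * b) * q) +
    C * ((K%:R + 1) / s + b) * q.
    by field; rewrite gt_eqF.
  by apply: lerD => //; exact: le_trans leq_K.
(* [X] is finite with nonnegative members, so its sum dominates each of them and finitely many
   layers exhaust [X]. *)
pose K := Num.bound (s * \sum_(t <- X) t).
have KP t : t \in X -> s * t < K%:R.
  move=> tX; have XT0 u : u \in X -> 0 <= u by move=> /XT/T_ge0.
  have su : s * t <= s * \sum_(t <- X) t.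
    rewrite ler_pM2l// (big_rem t)//= lerDl big_seq; apply: sumr_ge0 => u.
    by move=> /mem_rem /XT0.
  apply: le_lt_trans su _; apply: archi_boundP.
  by rewrite mulr_ge0 ?(ltW s0)// big_seq; exact: sumr_ge0.
rewrite big_seq (eq_bigl (fun t => (t \in X) && (s * t < K%:R))); last first.
  by move=> t; case: (boolP (t \in X)) => // /KP ->.
rewrite -big_seq_cond; apply: le_trans (layers K) _.
rewrite ler_pM2l// lerBlDr lerDl mulr_ge0 ?exprn_ge0// addr_ge0//.
  by rewrite divr_ge0 ?addr_ge0 ?mulr_ge0 ?(ltW s0).
by rewrite mulr_ge0// ltW.
Qed.

(** Invert [1 + s <= expR s]. Together with [oneBexpR_le] this makes [1 - expR (- s)] comparable to
    [s] for small [s]. *)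
Lemma oneBexpR_ge s : 0 < s -> s / (1 + s) <= 1 - expR (- s).
Proof.
move=> s0; rewrite lerBrDr -lerBrDl expRN.
have -> : 1 - s / (1 + s) = (1 + s)^-1 by field; rewrite gt_eqF// addr_gt0.
by rewrite lef_pV2 ?posrE ?expR_gt0 ?addr_gt0// expR_ge1Dx.
Qed.

Lemma oneBexpR_le s : 1 - expR (- s) <= s.
Proof. by have := expR_ge1Dx (- s); lra. Qed.

Lemma F_bounded_linear_growth : F_bounded T -> linear_growth T.
Proof.
move=> /F_boundedP[c [C [c0 cC SB]]].
have C0 : 0 < C by exact: lt_le_trans cC.
(* [A] is the value of [s * x] for the lower bound. The tail will be at most
   [(2 / A) * (3 * C / s)], which [A = 12 * C / c] turns into half of the main term [c / s]. *)
have [A cA] : exists A, c * A = 12 * C.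
  by exists (12 * C / c); field; rewrite gt_eqF.
have A12 : 12 <= A by rewrite -(ler_pM2l c0) cA; lra.
have A0 : 0 < A by lra.
have e1 : 1 <= expR 1 :> R by have := expR_ge1Dx (1 : R); lra.
exists (c / (2 * A)), (2 * expR 1 * C), A; split => //.
- by rewrite divr_gt0// mulr_gt0.
- apply: (@le_trans _ _ c); last by nra.
  have A20 : 0 < 2 * A by lra.
  rewrite ler_pdivrMr//.
  by rewrite mulrCA cA; lra.
move=> x Ax; have x0 : 0 < x by exact: lt_le_trans Ax.
apply/andP; split; last first.
  (* With [s * x = 1], the count times [expR (- 1)] is at most [C * (x + 1)], and [x + 1 <= 2 * x]
     since [x >= A >= 12]. *)
  pose s := x^-1; have s0 : 0 < s by rewrite invr_gt0.
  have sx : s * x = 1 by rewrite mulVf// gt_eqF.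
  have /andP[_ le_C] := SB s s0.
  have := le_trans (counting_fun_le_laplace_sum s0 x0) le_C.
  rewrite lee_fin sx ler_pdivlMr ?oneBexpR_gt0// => le_N.
  have N0 : 0 <= (counting_fun T x)%:R :> R by [].
  have e0 := expR_gt0 (1 : R).
  rewrite expRN in le_N.
  have le_s := oneBexpR_ge s0.
  have sV : s / (1 + s) = (x + 1)^-1 by rewrite /s; field; rewrite !gt_eqF// addr_gt0.
  rewrite sV in le_s.
  have : (counting_fun T x)%:R * (expR 1)^-1 * (x + 1)^-1 <= C.
    by apply: le_trans le_N; rewrite ler_wpM2l// divr_ge0// expR_ge0.
  rewrite ler_pdivrMr ?addr_gt0// ler_pdivrMr//; nra.
pose s := A / x; have s0 : 0 < s by rewrite divr_gt0.
have s1 : s <= 1 by rewrite ler_pdivrMr// mul1r.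
have sx : s * x = A by rewrite /s; field; rewrite gt_eqF.
have s20 : 0 < s / 2 by rewrite divr_gt0.
have /andP[le_c _] := SB s s0.
have /andP[_ le_C] := SB (s / 2) s20.
have := le_trans le_c (laplace_sum_tail s0 x0 le_C).
rewrite lee_fin sx => main.
have le1 : c / s <= c / (1 - expR (- s)).
  by rewrite ler_pM2l// lef_pV2 ?posrE ?oneBexpR_gt0// oneBexpR_le.
(* Here [s <= 1] matters: [1 - expR (- (s / 2)) >= s / (2 + s) >= s / 3]. *)
have le2 : C / (1 - expR (- (s / 2))) <= 3 * C / s.
  have h := oneBexpR_ge s20; have g := oneBexpR_gt0 s20.
  rewrite ler_pdivrMr//.
  apply: (@le_trans _ _ (3 * C / s * (s / 2 / (1 + s / 2)))); last first.
    by rewrite ler_wpM2l// divr_ge0 ?(ltW s0)// mulr_ge0// ltW.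
  have -> : 3 * C / s * (s / 2 / (1 + s / 2)) = 3 * C / (2 + s).
    by field; rewrite !gt_eqF// ?addr_gt0//; lra.
  by rewrite ler_pdivlMr ?addr_gt0//; nra.
have le3 : expR (- (A / 2)) <= 2 / A.
  rewrite expRN -[leRHS]invrK lef_pV2 ?posrE ?expR_gt0 ?invr_gt0 ?divr_gt0//.
  by have := expR_ge1Dx (A / 2); rewrite invf_div; lra.
have le4 : expR (- (A / 2)) * (C / (1 - expR (- (s / 2)))) <= c / 2 / s.
  apply: (@le_trans _ _ (2 / A * (3 * C / s))).
    apply: ler_pM => //.
    by apply: divr_ge0; apply: ltW => //; exact: oneBexpR_gt0.
  rewrite le_eqVlt; apply/orP; left; apply/eqP.
  have -> : C = c * A / 12 by rewrite cA; field.
  by field; rewrite !gt_eqF.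
have -> : c / (2 * A) * x = c / s - c / 2 / s.
  by rewrite /s; field; rewrite !gt_eqF.
rewrite lerBlDr; apply: le_trans le1 _; apply: le_trans main _.
by rewrite lerD2l.
Qed.

(** For [s <= x0^-1] the lower bound comes from the times up to [s^-1], a length covered by the
    growth hypothesis. For larger [s] the time 0 alone contributes 1, while [1 - expR (- s)] stays
    above a fixed positive number. *)
Lemma linear_growth_F_bounded : T 0 -> linear_growth T -> F_bounded T.
Proof.
move=> T0 [c [C [x0 [c0 cC x00 NB]]]]; apply/F_boundedP.
have C0 : 0 < C by exact: lt_le_trans cC.
have e0 := expR_gt0 (- 1 : R).
pose c1 := c * expR (- 1) / (1 + x0^-1).
have x0V : 0 < x0^-1 by rewrite invr_gt0.
have c10 : 0 < c1 by rewrite divr_gt0 ?mulr_gt0 ?addr_gt0.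
(* The first entry serves [s <= x0^-1], the second serves larger [s], and the third secures that
   [c2] is at most the upper constant. *)
pose c2 := Num.min c1 (Num.min (1 - expR (- x0^-1)) (C * (4 + 2 * x0))).
have x0e := oneBexpR_gt0 x0V.
have C20 : 0 < C * (4 + 2 * x0) by rewrite mulr_gt0// addr_gt0// mulr_gt0.
exists c2, (C * (4 + 2 * x0)); split => //.
- by rewrite !lt_min c10 x0e.
- by rewrite /c2 !ge_min lexx !orbT.
move=> s s0; have s1 := oneBexpR_gt0 s0; apply/andP; split; last first.
  (* Growth is known only from [x0] on; replacing [x] by [x + x0] gives a bound on the count for
     every [x > 0]. *)
  apply: le_trans (laplace_sum_le_linear s0 C0 x00 _) _.
    move=> x xp; have xx0 : x0 <= x + x0 by lra.
    apply: (@le_trans _ _ (counting_fun T (x + x0))%:R).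
      by rewrite ler_nat; apply: le_counting_fun => //; lra.
    by have /andP[] := NB _ xx0.
  rewrite lee_fin -mulrA ler_pM2l// ler_pdivlMr//.
  have h := oneBexpR_le s.
  have : (1 - expR (- s)) / s <= 1 by rewrite ler_pdivrMr// mul1r.
  have : 1 - expR (- s) <= 1 by have := expR_ge0 (- s); lra.
  move=> h1 h2; rewrite mulrDl mulrAC -mulrA; apply: lerD; first by nra.
  by rewrite -[leRHS]mulr1; rewrite ler_pM2l// mulr_gt0.
have [sx|sx] := leP s x0^-1.
  have sV : x0 <= s^-1 by rewrite -[x0]invrK lef_pV2// posrE.
  have sV0 : 0 < s^-1 by rewrite invr_gt0.
  apply: le_trans (counting_fun_le_laplace_sum s0 sV0).
  have /andP[+ _] := NB _ sV.
  rewrite lee_fin mulfV ?gt_eqF// => NB1.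
  apply: (@le_trans _ _ (c / s * expR (- 1))); last by rewrite ler_pM2r.
  apply: (@le_trans _ _ (c1 / (s / (1 + s)))).
    have s2 : 0 < s / (1 + s) by rewrite divr_gt0// addr_gt0.
    apply: ler_pM => //; first by rewrite !le_min !ltW.
    - by rewrite invr_ge0 ltW.
    - by rewrite ge_min lexx.
    - by rewrite lef_pV2 ?posrE// oneBexpR_ge.
  have -> : c1 / (s / (1 + s)) = c / s * expR (- 1) * ((1 + s) / (1 + x0^-1)).
    by rewrite /c1; field; rewrite !gt_eqF//= ?addr_gt0//; rewrite mulrC; nra.
  rewrite -[leRHS]mulr1 ler_pM2l ?mulr_gt0// ler_pdivrMr ?addr_gt0//; lra.
apply: le_trans (fset_sum_le_esum (X := [fset 0]%fset) _ _); last first.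
  by move=> t /=; rewrite inE => /eqP ->.
rewrite big_seq_fset1 mulr0 oppr0 expR0 lee_fin ler_pdivrMr// mul1r.
rewrite /c2; apply: (@le_trans _ _ (1 - expR (- x0^-1))).
  by rewrite !ge_min lexx !orbT.
by rewrite lerD2l lerN2 ler_expR lerN2 ltW.
Qed.

End Counting.
End LaplaceSum.

(** * The Hilbert space of square summable sequences *)

Local Notation Re := (@complex.Re _).
Local Notation Im := (@complex.Im _).

Section Ell2.
Context {R : realType}.
Local Open Scope complex_scope.
Implicit Types (z w : R[i]) (x y : nat -> R[i]).

(** The squared modulus as an element of [R], whereas the norm of [R[i]] takes values in [R[i]];
    series and limits can then be taken in [R]. *)
Definition abs2 z : R := Re z ^+ 2 + Im z ^+ 2.

Lemma abs2E z : (abs2 z)%:C = `|z| ^+ 2.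
Proof. exact: add_Re2_Im2. Qed.

Lemma abs2_ge0 z : 0 <= abs2 z.
Proof. by rewrite addr_ge0// sqr_ge0. Qed.

Lemma abs2M z w : abs2 (z * w) = abs2 z * abs2 w.
Proof. by case: z w => [a b] [c d]; rewrite /abs2 /=; ring. Qed.

Lemma abs2N z : abs2 (- z) = abs2 z.
Proof. by case: z => [a b]; rewrite /abs2 /=; ring. Qed.

Lemma abs2_real (a : R) : abs2 a%:C = a ^+ 2.
Proof. by rewrite /abs2 /= expr0n addr0. Qed.

(** The two sides differ by [l^-1 * abs2 (l * z - w)]. The free weight [l] stands in for the
    Cauchy-Schwarz inequality when the triangle inequality is proved. *)
Lemma abs2D_le (l : R) z w : 0 < l ->
  abs2 (z + w) <= (1 + l) * abs2 z + (1 + l^-1) * abs2 w.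
Proof.
case: z w => [a b] [c d] l0; rewrite /abs2 /= -subr_ge0.
have -> : (1 + l) * (a ^+ 2 + b ^+ 2) + (1 + l^-1) * (c ^+ 2 + d ^+ 2) -
    ((a + c) ^+ 2 + (b + d) ^+ 2) = l^-1 * ((l * a - c) ^+ 2 + (l * b - d) ^+ 2).
  by field; rewrite gt_eqF.
by rewrite mulr_ge0 ?invr_ge0 ?(ltW l0)// addr_ge0// sqr_ge0.
Qed.

Lemma abs2_eq0 z : abs2 z = 0 -> z = 0.
Proof.
by move=> z0; apply/eqP; rewrite -normr_eq0 -sqrf_eq0 -abs2E z0.
Qed.

Lemma cvg_series_bounded (u : nat -> R) (M : R) : (forall n, 0 <= u n) ->
  (forall n, series u n <= M) -> cvgn (series u).
Proof.
move=> u0 uM; apply: nondecreasing_is_cvgn.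
  by apply/nondecreasing_seqP => n; rewrite seriesEnat /= big_nat_recr//= lerDl.
by exists M => _ [n _ <-].
Qed.

Lemma series_le_lim (u : nat -> R) n : (forall n, 0 <= u n) ->
  cvgn (series u) -> series u n <= limn (series u).
Proof.
move=> u0 cu; apply: nondecreasing_cvgn_le => //.
by apply/nondecreasing_seqP => k; rewrite seriesEnat /= big_nat_recr//= lerDl.
Qed.

Definition square_summable : {pred nat -> R[i]} :=
  fun x => `[< cvgn (series (abs2 \o x)) >].

Lemma square_summableP x : reflect (cvgn (series (abs2 \o x))) (x \in square_summable).
Proof. exact: asboolP. Qed.

Definition sqnorm x : R := limn (series (abs2 \o x)).

Lemma series_le_sqnorm x n : x \in square_summable ->
  series (abs2 \o x) n <= sqnorm x.
Proof. by move=> /square_summableP; apply: series_le_lim => k; exact: abs2_ge0. Qed.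

Lemma sqnorm_le x (M : R) : (forall n, series (abs2 \o x) n <= M) ->
  x \in square_summable /\ sqnorm x <= M.
Proof.
move=> xM; have cx : cvgn (series (abs2 \o x)).
  by apply: cvg_series_bounded xM => n; exact: abs2_ge0.
split; first exact/square_summableP.
by apply: limr_le => //; near=> n.
Unshelve. all: by end_near. Qed.

Lemma sqnormD_le (l : R) x y : 0 < l -> x \in square_summable ->
  y \in square_summable -> x + y \in square_summable /\
  sqnorm (x + y) <= (1 + l) * sqnorm x + (1 + l^-1) * sqnorm y.
Proof.
move=> l0 cx cy; apply: sqnorm_le => n.
apply: (@le_trans _ _ ((1 + l) * series (abs2 \o x) n +
    (1 + l^-1) * series (abs2 \o y) n)).
  rewrite !seriesEnat /= 2!mulr_sumr -big_split; apply: ler_sum => k _ /=.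
  exact: abs2D_le.
by apply: lerD; rewrite ler_pM2l ?addr_gt0 ?invr_gt0// series_le_sqnorm.
Qed.

Lemma sqnormM_le (d : nat -> R[i]) x (M : R) : (forall n, abs2 (d n) <= M) ->
  x \in square_summable -> (fun n => d n * x n) \in square_summable /\
  sqnorm (fun n => d n * x n) <= M * sqnorm x.
Proof.
move=> dM cx; have M0 : 0 <= M := le_trans (abs2_ge0 _) (dM 0%N).
apply: sqnorm_le => n; apply: le_trans (ler_wpM2l M0 (series_le_sqnorm n cx)).
rewrite !seriesEnat /= mulr_sumr; apply: ler_sum => k _ /=.
by rewrite abs2M ler_wpM2r ?abs2_ge0.
Qed.

Lemma square_summable_submod : submod_closed square_summable.
Proof.
split=> [|a x y cx cy].
  suff h n : series (abs2 \o (0 : nat -> R[i])) n <= 0 by case: (sqnorm_le h).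
  by rewrite seriesEnat /= big1// => k _; rewrite /abs2 /= expr0n addr0.
have [cax _] := @sqnormM_le (fun=> a) x (abs2 a) (fun=> lexx _) cx.
by have [] := sqnormD_le ltr01 cax cy.
Qed.

HB.instance Definition _ :=
  GRing.isSubmodClosed.Build R[i] (nat -> R[i]) square_summable square_summable_submod.

Record ell2 := Ell2 { ell2_fun :> nat -> R[i] ;
  _ : ell2_fun \in square_summable }.

HB.instance Definition _ := [isSub for ell2_fun].
HB.instance Definition _ := [Choice of ell2 by <:].
HB.instance Definition _ := [SubChoice_isSubLmodule of ell2 by <:].

Implicit Types u v : ell2.

Lemma ell2P u : (u : nat -> R[i]) \in square_summable.
Proof. exact: valP. Qed.

Lemma ell2_eq u v : (forall n, u n = v n) -> u = v.
Proof. by move=> uv; apply/val_inj/funext. Qed.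

Lemma sqnorm_ge0 u : 0 <= sqnorm u.
Proof.
apply: le_trans (series_le_sqnorm 0 (ell2P u)).
by rewrite seriesEnat /= big_nil.
Qed.

Lemma abs2_le_sqnorm u n : abs2 (u n) <= sqnorm u.
Proof.
apply: le_trans (series_le_sqnorm n.+1 (ell2P u)).
rewrite seriesEnat /= big_nat_recr//= lerDr; apply: sumr_ge0 => k _.
exact: abs2_ge0.
Qed.

Lemma sqnorm_eq0 u : sqnorm u = 0 -> u = 0.
Proof.
move=> u0; apply: ell2_eq => n; apply: abs2_eq0; apply/le_anti.
by rewrite abs2_ge0 -u0 abs2_le_sqnorm.
Qed.

Lemma sqnormZ (a : R[i]) u : sqnorm (a *: u) = abs2 a * sqnorm u.
Proof.
apply: cvg_lim => //.
rewrite (_ : series _ = (fun n => abs2 a * series (abs2 \o u) n)).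
  by apply: cvgM; [exact: cvg_cst|exact/square_summableP/ell2P].
apply/funext => n; rewrite /= !seriesEnat /= mulr_sumr; apply: eq_bigr => k _.
exact: abs2M.
Qed.

(** With [a], [b] the two norms, the weight [l = b / a] makes the bound of [sqnormD_le] equal to
    [(a + b) ^+ 2]. Zero norms are split off to keep [l] positive. *)
Lemma sqrt_sqnormD u v :
  Num.sqrt (sqnorm (u + v)) <= Num.sqrt (sqnorm u) + Num.sqrt (sqnorm v).
Proof.
have [u0|u0] := eqVneq (sqnorm u) 0.
  by rewrite (sqnorm_eq0 u0) add0r lerDr sqrtr_ge0.
have [v0|v0] := eqVneq (sqnorm v) 0.
  by rewrite (sqnorm_eq0 v0) addr0 lerDl sqrtr_ge0.
set a := Num.sqrt (sqnorm u); set b := Num.sqrt (sqnorm v).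
have a0 : 0 < a by rewrite sqrtr_gt0 lt_def u0 sqnorm_ge0.
have b0 : 0 < b by rewrite sqrtr_gt0 lt_def v0 sqnorm_ge0.
rewrite -(@ger0_norm _ (a + b)) ?addr_ge0 ?(ltW a0) ?(ltW b0)// -sqrtr_sqr.
apply: ler_wsqrtr; have ba : 0 < b / a by rewrite divr_gt0.
have [_] := sqnormD_le ba (ell2P u) (ell2P v).
rewrite -(sqr_sqrtr (sqnorm_ge0 u)) -(sqr_sqrtr (sqnorm_ge0 v)) -/a -/b.
have -> : (1 + b / a) * a ^+ 2 + (1 + (b / a)^-1) * b ^+ 2 = (a + b) ^+ 2.
  by field; rewrite !gt_eqF.
exact.
Qed.

Definition ell2_norm u : R[i] := (Num.sqrt (sqnorm u))%:C.

Lemma ell2_normD u v : ell2_norm (u + v) <= ell2_norm u + ell2_norm v.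
Proof. by rewrite /ell2_norm -rmorphD lecR sqrt_sqnormD. Qed.

Lemma ell2_normZ (a : R[i]) u : ell2_norm (a *: u) = `|a| * ell2_norm u.
Proof.
rewrite /ell2_norm sqnormZ sqrtrM ?abs2_ge0// rmorphM; congr (_ * _).
by rewrite normc_def.
Qed.

Lemma ell2_norm_eq0 u : ell2_norm u = 0 -> u = 0.
Proof.
move=> [] /eqP; rewrite sqrtr_eq0 => u0.
by apply/sqnorm_eq0/le_anti; rewrite u0 sqnorm_ge0.
Qed.

HB.instance Definition _ := @Lmodule_isNormed.Build R[i] ell2
  ell2_norm ell2_normD ell2_normZ ell2_norm_eq0.

Lemma ell2_normE u : `|u| = (Num.sqrt (sqnorm u))%:C.
Proof. by []. Qed.

Lemma ell2_norm_sqr u : `|u| ^+ 2 = (sqnorm u)%:C.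
Proof. by rewrite ell2_normE -rmorphXn /= sqr_sqrtr// sqnorm_ge0. Qed.

(** Convergence of a complex series, taken separately on real and imaginary parts. The algebraic
    identities of the inner product follow from uniqueness of such sums. *)
Definition csum_to (f : nat -> R[i]) z :=
  series (Re \o f) @ \oo --> Re z /\ series (Im \o f) @ \oo --> Im z.

Lemma csum_to_unique f z w : csum_to f z -> csum_to f w -> z = w.
Proof.
move=> [fz1 fz2] [fw1 fw2]; apply/eqP; rewrite eq_complex.
by rewrite (cvg_unique _ fz1 fw1) ?(cvg_unique _ fz2 fw2) ?eqxx//; exact: norm_hausdorff.
Qed.

Lemma csum_toP (a : R[i]) f g z w : csum_to f z -> csum_to g w ->
  csum_to (fun n => a * f n + g n) (a * z + w).
Proof.
move=> [fz1 fz2] [gw1 gw2]; split.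
  have -> : Re (a * z + w) = Re a * Re z - Im a * Im z + Re w.
    by case: a z w {fz1 fz2 gw1 gw2} => [? ?] [? ?] [? ?].
  rewrite (_ : series _ = (fun n => Re a * series (Re \o f) n - Im a * series (Im \o f) n
      + series (Re \o g) n)).
    by apply: cvgD => //; apply: cvgB; apply: cvgM => //; exact: cvg_cst.
  apply/funext => n; rewrite /= !seriesEnat /= !mulr_sumr -sumrB -big_split.
  by apply: eq_bigr => k _ /=; case: (a) (f k) (g k) => [? ?] [? ?] [? ?].
have -> : Im (a * z + w) = Re a * Im z + Im a * Re z + Im w.
  by case: a z w {fz1 fz2 gw1 gw2} => [? ?] [? ?] [? ?].
rewrite (_ : series _ = (fun n => Re a * series (Im \o f) n + Im a * series (Re \o f) n
    + series (Im \o g) n)).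
  by apply: cvgD => //; apply: cvgD; apply: cvgM => //; exact: cvg_cst.
apply/funext => n; rewrite /= !seriesEnat /= !mulr_sumr -!big_split.
by apply: eq_bigr => k _ /=; case: (a) (f k) (g k) => [? ?] [? ?] [? ?].
Qed.

Lemma csum_to_conj f z : csum_to f z -> csum_to (fun n => (f n)^*) z^*.
Proof.
move=> [fz1 fz2]; split.
  rewrite (_ : Re z^* = Re z); last by case: (z).
  rewrite (_ : series _ = series (Re \o f))//; apply/funext => n.
  by rewrite !seriesEnat /=; apply: eq_bigr => k _ /=; case: (f k).
rewrite (_ : Im z^* = - Im z); last by case: (z).
rewrite (_ : series _ = (fun n => - series (Im \o f) n)); first exact: cvgN.
apply/funext => n; rewrite !seriesEnat /= -sumrN.
by apply: eq_bigr => k _ /=; case: (f k).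
Qed.

Definition ell2_dot u v : R[i] :=
  limn (series (fun n => Re (u n * (v n)^*))) +i*
  limn (series (fun n => Im (u n * (v n)^*))).

Lemma ell2_dotP u v : csum_to (fun n => u n * (v n)^*) (ell2_dot u v).
Proof.
(* Absolute convergence by comparison; the squares listed below supply the inequalities between
   products and sums of squares. *)
have bnd n : `|Re (u n * (v n)^*)| <= abs2 (u n) + abs2 (v n) /\
    `|Im (u n * (v n)^*)| <= abs2 (u n) + abs2 (v n).
  case: (u n) (v n) => [a b] [c d]; rewrite /abs2 /= !ler_norml.
  have := sqr_ge0 (a - c); have := sqr_ge0 (b - d).
  have := sqr_ge0 (a + c); have := sqr_ge0 (b + d).
  have := sqr_ge0 (a - d); have := sqr_ge0 (b - c).
  have := sqr_ge0 (a + d); have := sqr_ge0 (b + c).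
  have := sqr_ge0 a; have := sqr_ge0 b; have := sqr_ge0 c; have := sqr_ge0 d.
  by rewrite !sqrrD !sqrrN => *; split; apply/andP; split; lra.
have cuv : cvgn (series (fun n => abs2 (u n) + abs2 (v n))).
  have := is_cvg_seriesD (elimT (square_summableP _) (ell2P u))
    (elimT (square_summableP _) (ell2P v)).
  exact.
have s0 n : 0 <= abs2 (u n) + abs2 (v n) by rewrite addr_ge0// abs2_ge0.
by split; apply: normed_cvg; apply: series_le_cvg cuv => n //=; case: (bnd n).
Qed.

Lemma ell2_dot_bilinear : bilinear_for *%R (Num.conj \; *%R) ell2_dot.
Proof.
split=> [v a u w|u a v w] /=.
  apply: csum_to_unique (ell2_dotP _ _) _.
  have := csum_toP a (ell2_dotP u v) (ell2_dotP w v).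
  congr csum_to; apply/funext => n /=.
  by rewrite mulrDl mulrA.
apply: csum_to_unique (ell2_dotP _ _) _.
have := csum_toP a^* (ell2_dotP u v) (ell2_dotP u w).
congr csum_to; apply/funext => n /=.
by rewrite rmorphD rmorphM mulrDr mulrCA.
Qed.

HB.instance Definition _ := bilinear_isBilinear.Build R[i] ell2 ell2 R[i]
  _ _ ell2_dot ell2_dot_bilinear.

Lemma ell2_dotC u v : ell2_dot u v = (-1) ^+ false * Num.conj (ell2_dot v u).
Proof.
rewrite expr0 mul1r; apply: csum_to_unique (ell2_dotP _ _) _.
have := csum_to_conj (ell2_dotP v u); congr csum_to; apply/funext => n /=.
by rewrite rmorphM [X in _ * X]conjcK mulrC.
Qed.

HB.instance Definition _ := isHermitianSesquilinear.Build R[i] ell2 false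
  (@Num.conj R[i]) ell2_dot ell2_dotC.

Lemma ell2_dotE u : ell2_dot u u = `|u| ^+ 2.
Proof.
rewrite ell2_norm_sqr; apply: csum_to_unique (ell2_dotP _ _) _; split.
  rewrite /=.
  rewrite (_ : Re \o _ = abs2 \o u); first exact/square_summableP/ell2P.
  by apply/funext => n /=; case: (u n) => [a b]; rewrite /abs2 /=; ring.
rewrite (_ : series _ = cst 0); first exact: cvg_cst.
apply/funext => n; rewrite seriesEnat /= big1// => k _ /=.
by case: (u k) => a b /=; ring.
Qed.

Lemma ell2_dot_gt0 u : u != 0 -> 0 < ell2_dot u u.
Proof. by move=> u0; rewrite ell2_dotE exprn_gt0// normr_gt0. Qed.

HB.instance Definition _ := isDotProduct.Build R[i] ell2 ell2_dot ell2_dot_gt0.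

End Ell2.

(** * Completeness of the space of square summable sequences *)

Section Ell2Complete.
Context {R : realType}.
Local Open Scope complex_scope.
Local Notation ell2 := (@ell2 R).
Implicit Types u v : ell2.

(** The order of [R[i]] compares only numbers with equal imaginary parts, so the radii of balls are
    real. *)
Lemma gtc0_real (e : R[i]) : 0 < e -> 0 < Re e /\ e = (Re e)%:C.
Proof.
rewrite ltcE /= => /andP[/eqP e0 ?]; split => //.
by apply/eqP; rewrite eq_complex /= e0 !eqxx.
Qed.

Lemma ReB (z w : R[i]) : Re (z - w) = Re z - Re w.
Proof. by case: z w => [? ?] [? ?]. Qed.

Lemma ImB (z w : R[i]) : Im (z - w) = Im z - Im w.
Proof. by case: z w => [? ?] [? ?]. Qed.

Lemma ell2_norm_lt u (e : R) : 0 < e -> (`|u| < e%:C) = (sqnorm u < e ^+ 2).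
Proof.
move=> e0; rewrite ell2_normE ltcR -{1}(ger0_norm (ltW e0)) -sqrtr_sqr.
by rewrite ltr_sqrt ?exprn_gt0.
Qed.

(** Coordinates converge along the filter, which gives a candidate limit [l]. Cauchy bounds on
    finite partial sums pass to the limit, and then bound the full distance to [l]. *)
Lemma ell2_complete (F : set_system ell2) : ProperFilter F -> cauchy F -> cvg F.
Proof.
move=> FF /(cauchyP F) Fc.
have Fball (e : R) : 0 < e -> exists u, F [set v | sqnorm (u - v) < e ^+ 2].
  move=> e0; have [|u Fu] := Fc e%:C; first by rewrite ltcR.
  exists u; apply: filterS Fu => v.
  by rewrite -ball_normE /ball_ /= ell2_norm_lt.
have coord_cvg (p : R[i] -> R) : (forall z w, p (z - w) = p z - p w) ->
    (forall z, p z ^+ 2 <= abs2 z) ->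
    forall n, cvg ((fun u : ell2 => p (u n)) @ F).
  move=> pB p_le n; apply/cauchy_cvgP/cauchyP => e e0.
  have [u Fu] := Fball e e0; exists (p (u n)).
  apply: (@filterS _ F _ _ _ _ Fu) => v uv; rewrite -ball_normE /ball_ /=.
  rewrite -pB -(@ltr_pXn2r _ 2) ?nnegrE ?(ltW e0)// real_normK ?num_real//.
  apply: le_lt_trans (p_le _) (le_lt_trans _ uv).
  exact: (abs2_le_sqnorm (u - v) n).
have reF n : (fun u : ell2 => Re (u n)) @ F --> lim ((fun u : ell2 => Re (u n)) @ F).
  apply: coord_cvg => [z w|z]; first exact: ReB.
  by rewrite /abs2 lerDl sqr_ge0.
have imF n : (fun u : ell2 => Im (u n)) @ F --> lim ((fun u : ell2 => Im (u n)) @ F).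
  apply: coord_cvg => [z w|z]; first exact: ImB.
  by rewrite /abs2 lerDr sqr_ge0.
pose l n := lim ((fun u : ell2 => Re (u n)) @ F) +i* lim ((fun u : ell2 => Im (u n)) @ F).
pose dl (u : ell2) : nat -> R[i] := fun n => u n - l n.
(* Both [u] and [v] lie near a common centre [w]; the factors [1 + 1] come from [sqnormD_le] with
   [l = 1]. For fixed [n] the partial sum converges as [v] runs along [F]. *)
have near_l (e : R) : 0 < e -> F [set u | dl u \in square_summable /\
    sqnorm (dl u) <= (1 + 1) * e ^+ 2 + (1 + 1) * e ^+ 2].
  move=> e0; have [w Fw] := Fball e e0.
  apply: filterS (Fw) => u wu; apply: sqnorm_le => n.
  have : (fun v : ell2 => series (abs2 \o (u - v : ell2)) n) @ F -->
      series (abs2 \o dl u) n.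
    rewrite !seriesEnat /= /series /=.
    apply: cvg_big => [x|k _]; first exact: add_continuous.
    rewrite /abs2 /dl ReB ImB (_ : (fun _ => _) = (fun v : ell2 =>
      (Re (u k) - Re (v k)) ^+ 2 + (Im (u k) - Im (v k)) ^+ 2)); last first.
      by apply/funext => v /=; rewrite -ReB -ImB.
    have sq (f : ell2 -> R) (p q : R) : f @ F --> q ->
        (p - f v) ^+ 2 @[v --> F] --> (p - q) ^+ 2.
      by move=> fq; apply: cvgM; apply: cvgB => //; exact: cvg_cst.
    by apply: cvgD; apply: sq; [exact: reF|exact: imF].
  move=> /ler_cvg_to; apply; first exact: cvg_cst.
  apply: filterS Fw => v wv.
  apply: le_trans (series_le_sqnorm n (ell2P _)) _.
  have -> : u - v = (u - w) + (w - v) by rewrite addrA subrK.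
  have [_] := sqnormD_le ltr01 (ell2P (u - w)) (ell2P (w - v)).
  rewrite invr1 => /le_trans; apply; apply: lerD; rewrite ler_pM2l ?ltW ?addr_gt0//.
  by rewrite -opprB -scaleN1r sqnormZ abs2N abs2_real expr1n mul1r.
have l2 : l \in square_summable.
  have [u [ul _]] := filter_ex (near_l 1 ltr01).
  have -> : l = (u : nat -> R[i]) - dl u by apply/funext => n; rewrite /dl /= [RHS]subKr.
  by rewrite rpredB ?ell2P.
apply/cvg_ex; exists (Ell2 l2); apply/fcvgrPdist_lt => e /gtc0_real [].
(* The radius [r / 3] suffices because [4 * (r / 3) ^+ 2 < r ^+ 2]. *)
set r := Re e => r0 ->; have r20 : 0 < r / 3 by rewrite divr_gt0.
apply: filterS (near_l _ r20) => u [_ ul] /=.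
rewrite -normrN opprB ell2_norm_lt//; apply: le_lt_trans ul _.
by rewrite expr_div_n; have := exprn_gt0 2 r0; lra.
Qed.

HB.instance Definition _ := Uniform_isComplete.Build ell2 ell2_complete.

Definition ell2_hilbert : hilbert R := @Hilbert R ell2 (@ell2_dot R) (@ell2_dotE R).

End Ell2Complete.

(** * The standard basis and separability *)

Section Ell2Basis.
Context {R : realType}.
Local Open Scope complex_scope.
Local Notation ell2 := (@ell2 R).
Implicit Types u v : ell2.

Lemma cvg_series_single (f : nat -> R) n : (forall k, k != n -> f k = 0) ->
  series f @ \oo --> f n.
Proof.
move=> fn; have sE m : series f m = if (n < m)%N then f n else 0.
  rewrite seriesEnat /=; elim: m => [|m IH]; first by rewrite big_nil.
  rewrite big_nat_recr//= IH ltnS [(_ <= _)%N in RHS]leq_eqVlt.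
  have [->|nm] := eqVneq n m; first by rewrite ltnn add0r.
  by rewrite (fn m) ?addr0// eq_sym.
apply: cvg_near_cst; exists n.+1 => // m /= nm; apply/eqP.
by rewrite sE nm.
Qed.

Let delta n : nat -> R[i] := fun k => (k == n)%:R.

Let abs2_delta n : series (abs2 \o delta n) @ \oo --> (1 : R).
Proof.
rewrite (_ : 1 = (abs2 \o delta n) n).
  by apply: cvg_series_single => k /negbTE kn; rewrite /= /delta kn /abs2 /= expr0n addr0.
by rewrite /= /delta eqxx abs2_real expr1n.
Qed.

Let delta_in n : delta n \in square_summable.
Proof. by apply/square_summableP/cvg_ex; exists 1. Qed.

Definition ell2_basis n : ell2 := Ell2 (delta_in n).

Lemma ell2_basisE n k : ell2_basis n k = (k == n)%:R.
Proof. by []. Qed.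

Lemma sqnorm_basis n : sqnorm (ell2_basis n) = 1.
Proof. by apply: cvg_lim => //; exact: abs2_delta. Qed.

Lemma ell2_dot_basis u n : ell2_dot u (ell2_basis n) = u n.
Proof.
apply: csum_to_unique (ell2_dotP _ _) _.
have E k : u k * (ell2_basis n k)^* = if k == n then u k else 0.
  by rewrite ell2_basisE rmorph_nat mulr_natr mulrb.
have En (p : R[i] -> R) : p (u n) = p (u n * (ell2_basis n n)^*) by rewrite E eqxx.
split; rewrite En.
  apply: (@cvg_series_single (fun k => Re (u k * (ell2_basis n k)^*))) => k.
  by move=> /negbTE kn; rewrite E kn.
apply: (@cvg_series_single (fun k => Im (u k * (ell2_basis n k)^*))) => k.
by move=> /negbTE kn; rewrite E kn.
Qed.

Lemma ratC_dense (z : R[i]) (e : R) : 0 < e ->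
  exists q : rat * rat, abs2 (z - (ratr q.1 +i* ratr q.2)) <= e.
Proof.
move=> e0; pose d := Num.min 1 (e / 2).
have d0 : 0 < d by rewrite lt_min ltr01 divr_gt0.
have dd : d ^+ 2 <= e / 2.
  rewrite expr2 -[leRHS]mul1r; apply: ler_pM; rewrite ?(ltW d0) ?ge_min ?lexx ?orbT//.
have approx (x : R) : exists q : rat, (x - ratr q) ^+ 2 <= e / 2.
  have [|q] := @rat_in_itvoo R (x - d) (x + d); first by lra.
  rewrite in_itv /= => /andP[q1 q2]; exists q; apply: le_trans dd.
  nra.
case: z => a b; have [p ap] := approx a; have [q bq] := approx b.
by exists (p, q); rewrite /abs2 /=; lra.
Qed.

(** Finitely supported vectors with rational coordinates, indexed by a countable type so that their
    range is countable. *)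
Definition rat_point (s : seq (rat * rat)) : ell2 :=
  \sum_(k < size s) (ratr (nth 0 s k).1 +i* ratr (nth 0 s k).2) *: ell2_basis k.

Lemma sum_basisE N (c : nat -> R[i]) n :
  (\sum_(k < N) c k *: ell2_basis k : ell2) n = if (n < N)%N then c n else 0.
Proof.
elim: N => [|N IH]; first by rewrite big_ord0.
rewrite big_ord_recr /=.
transitivity ((\sum_(k < N) c k *: ell2_basis k : ell2) n + c N * ell2_basis N n) => //.
rewrite IH ell2_basisE ltnS [(_ <= _)%N in RHS]leq_eqVlt.
have [->|nN] := eqVneq n N; first by rewrite ltnn add0r mulr1.
by rewrite orFb mulr0 addr0.
Qed.

(** Cut [u] off where the remaining mass is below [e ^+ 2 / 2], then approximate the finitely many
    remaining coordinates by rational ones with total error at most [e ^+ 2 / 2]. *)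
Lemma ell2_separable : separable (@ell2_hilbert R).
Proof.
exists (range rat_point); first exact: sub_countable (card_image_le _ _) (countableP _).
move=> O [u Ou] Oopen.
have : nbhs (u : ell2) O by exact: open_nbhs_nbhs.
move=> /nbhs_ballP[e0 /= /gtc0_real [e0_gt0 ->]]; set e := Re e0; rewrite -/e in e0_gt0 *.
move=> eO.
have e2 : 0 < e ^+ 2 by rewrite exprn_gt0.
have cu : series (abs2 \o u) @ \oo --> sqnorm u by exact/square_summableP/ell2P.
have /cvgrPdist_lt /(_ (e ^+ 2 / 2)) := cu.
rewrite divr_gt0// => /(_ isT) [N _ /(_ N)]; rewrite /= leqnn => /(_ isT) uN.
(* Dividing by [N + 1] instead of [N] also covers [N = 0]. *)
have d0 : 0 < e ^+ 2 / 2 / (N%:R + 1) by rewrite !divr_gt0// addr_gt0.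
have [q qP] := choice (fun k => ratC_dense (u k) d0).
pose w := rat_point (mkseq q N).
have wE n : w n = if (n < N)%N then ratr (q n).1 +i* ratr (q n).2 else 0.
  rewrite /w /rat_point size_mkseq.
  rewrite (eq_bigr (fun k : 'I_N => (ratr (q k).1 +i* ratr (q k).2) *: ell2_basis k)).
    by rewrite (sum_basisE N (fun k => ratr (q k).1 +i* ratr (q k).2)).
  by move=> k _; rewrite nth_mkseq.
exists w; split; last by exists (mkseq q N).
apply: eO; rewrite -ball_normE /ball_ /= ell2_norm_lt//.
have [v uwv] : exists v : ell2, u - w = v by exists (u - w).
rewrite uwv; have vE k : v k = u k - w k by rewrite -uwv.
suff h n : series (abs2 \o v) n <=
    N%:R * (e ^+ 2 / 2 / (N%:R + 1)) + (sqnorm u - series (abs2 \o u) N).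
  have [_ /le_lt_trans] := sqnorm_le h; apply.
  have h1 : N%:R * (e ^+ 2 / 2 / (N%:R + 1)) <= e ^+ 2 / 2.
    have N1 : 0 < N%:R + 1 :> R by rewrite natr1.
    rewrite mulrA ler_pdivrMr// mulrC ler_pM2l; first lra.
    by rewrite divr_gt0.
  have := le_lt_trans (ler_norm _) uN; lra.
(* Lengthening the partial sum to [N + n] terms allows a split at [N] even when [n < N]. *)
apply: (@le_trans _ _ (series (abs2 \o v) (N + n)%N)).
  rewrite addnC; elim: (N) => [|m IH]; first by rewrite addn0.
  apply: le_trans IH _; rewrite addnS seriesEnat /= big_nat_recr//= lerDl.
  exact: abs2_ge0.
rewrite seriesEnat /= (@big_cat_nat _ _ _ N) ?leq_addr//=; apply: lerD.
  apply: (@le_trans _ _ (\sum_(0 <= k < N) (e ^+ 2 / 2 / (N%:R + 1)))).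
    rewrite big_nat [leRHS]big_nat; apply: ler_sum => k /andP[_ kN].
    by rewrite vE wE kN; exact: qP.
  by rewrite sumr_const_nat subn0 mulr_natl.
rewrite lerBrDl; apply: le_trans (series_le_sqnorm (N + n)%N (ell2P u)).
rewrite !seriesEnat /= [leRHS](@big_cat_nat _ _ _ N) ?leq_addr//= lerD2l.
rewrite big_nat [leRHS]big_nat; apply: ler_sum => k /andP[Nk _].
by rewrite vE wE ltnNge Nk subr0.
Qed.

End Ell2Basis.

(** * Diagonal operators and their functional calculus *)

Section Diagonal.
Context {R : realType}.
Local Open Scope complex_scope.
Local Notation ell2 := (@ell2 R).
Local Notation H := (@ell2_hilbert R).
Implicit Types (u v : ell2) (d : nat -> R[i]).

Definition bounded_sequence d := exists M : R, forall n, abs2 (d n) <= M.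

(* The zero operator when [d] is unbounded, so as to be linear for every [d]. *)
Definition diag d u : ell2 :=
  if `[< bounded_sequence d >] then insubd 0 (fun n => d n * u n) else 0.

Lemma diagE d u n : bounded_sequence d -> diag d u n = d n * u n.
Proof.
move=> bd; rewrite /diag asboolT//; have [M dM] := bd.
have [du _] := sqnormM_le dM (ell2P u).
by rewrite -[LHS]/(\val _ n) val_insubd du.
Qed.

Lemma diag_linear d : linear (diag d).
Proof.
have [bd|bd] := pselect (bounded_sequence d); last first.
  by move=> a u v; rewrite /diag asboolF// scaler0 addr0.
move=> a u v; apply: ell2_eq => n.
transitivity (a * diag d u n + diag d v n) => //; rewrite !diagE//.
transitivity (d n * (a * u n + v n)) => //.
by rewrite mulrDr mulrCA.
Qed.

HB.instance Definition _ d :=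
  GRing.isLinear.Build R[i] ell2 ell2 *:%R (diag d) (diag_linear d).

Lemma diag_continuous d : continuous (diag d).
Proof.
have [[M dM]|bd] := pselect (bounded_sequence d); last first.
  have -> : diag d = cst 0 by apply/funext => u; rewrite /diag asboolF.
  exact: cst_continuous.
apply/linear_bounded_continuous/linear_boundedP.
have M0 : 0 <= M := le_trans (abs2_ge0 _) (dM 0%N).
exists (Num.sqrt M)%:C; split; first by rewrite ger0_real// ler0c sqrtr_ge0.
move=> x Mx u; apply: (@le_trans _ _ ((Num.sqrt M)%:C * `|u|)); last first.
  by rewrite ler_wpM2r// ltW.
rewrite !ell2_normE -rmorphM lecR -sqrtrM//; apply: ler_wsqrtr.
have [_] := sqnormM_le dM (ell2P u); apply: le_trans.
rewrite (_ : diag d u = (fun n => d n * u n) :> (nat -> R[i]))//.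
by apply/funext => n; rewrite diagE//; exists M.
Qed.

Lemma bounded_conj d : bounded_sequence d -> bounded_sequence (fun n => (d n)^*).
Proof.
by move=> [M dM]; exists M => n; have := dM n; case: (d n) => a b; rewrite /abs2 /= sqrrN.
Qed.

Lemma diag_adjoint d u v : bounded_sequence d ->
  ell2_dot (diag d u) v = ell2_dot u (diag (fun n => (d n)^*) v).
Proof.
move=> bd; apply: csum_to_unique (ell2_dotP _ _) _.
have := ell2_dotP u (diag (fun n => (d n)^*) v).
congr csum_to; apply/funext => n; rewrite !diagE//; last exact: bounded_conj.
by rewrite rmorphM /= conjCK mulrA [u n * _]mulrC.
Qed.

Lemma diag_basis d n : bounded_sequence d ->
  diag d (ell2_basis n) = d n *: ell2_basis n.
Proof.
move=> bd; apply: ell2_eq => k; rewrite diagE//.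
transitivity (d n * ell2_basis n k) => //; rewrite ell2_basisE.
by have [->|_] := eqVneq k n; rewrite ?mulr0.
Qed.

Definition diagop d : {linear H -> H} := (diag d : {linear ell2 -> ell2}).

(** The spectrum is the closure of the entries. If the entries stay away from [z], the inverses of
    [d k - z] form a bounded diagonal inverse; if they come close, an inverse would have to stretch
    basis vectors by arbitrarily large factors. *)
Lemma spectrum_diagP d (z : R[i]) : bounded_sequence d ->
  spectrum (diagop d) z <-> forall e : R, 0 < e -> exists k, abs2 (d k - z) < e.
Proof.
move=> bd; split.
  apply: contra_notP => /existsNP[e /not_implyP[e0 /forallNP ez]].
  have {}ez k : e <= abs2 (d k - z) by rewrite leNgt; exact/negP/ez.
  have dz0 k : d k - z != 0.
    by apply/eqP => dz; have := ez k; rewrite dz leNgt /abs2 /= expr0n addr0 e0.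
  have bi : bounded_sequence (fun k => (d k - z)^-1).
    exists e^-1 => k; rewrite -[leLHS]mulr1.
    have dk0 : 0 < abs2 (d k - z) := lt_le_trans e0 (ez k).
    rewrite -(mulfV (lt0r_neq0 dk0)) mulrA -abs2M mulVf// abs2_real expr1n mul1r.
    by rewrite lef_pV2.
  exists (diagop (fun k => (d k - z)^-1)); split; first exact: diag_continuous.
  - move=> x; apply: ell2_eq => n; rewrite /= diagE//.
    transitivity ((d n - z)^-1 * (diag d x n - z * x n)) => //.
    by rewrite diagE// -mulrBl mulKf.
  - move=> x; apply: ell2_eq => n.
    transitivity (diag d (diag (fun k => (d k - z)^-1) x) n -
      z * diag (fun k => (d k - z)^-1) x n) => //.
    by rewrite !diagE// -mulrBl mulVKf.
move=> zd [B [Bc BA _]].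
have [M M0 BM] : exists2 M : R, 0 < M & forall x : H, `|B x| <= M%:C * `|x|.
  have /linear_boundedP/pinfty_ex_gt0[M /gtc0_real[M0 ->] BM] :
    bounded_near B (nbhs 0) by apply/linear_bounded_continuous.
  by exists (Re M).
(* [B] sends [(d k - z) *: ell2_basis k] to a unit vector, so the modulus of [d k - z] is at least
   [M^-1]; [abs2] squares this. *)
have [|k] := zd (M ^- 2); first by rewrite invr_gt0 exprn_gt0.
apply/negP; rewrite -leNgt.
have := BM ((d k - z) *: (ell2_basis k : H)).
have {1}-> : (d k - z) *: (ell2_basis k : H) =
    diagop d (ell2_basis k) - z *: (ell2_basis k : H).
  by rewrite scalerBl /= diag_basis.
rewrite BA normrZ ell2_normE sqnorm_basis sqrtr1 mulr1.
rewrite normc_def -rmorphM lecR -/(abs2 _); set a := abs2 _ => h.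
have a0 : 0 <= a by exact: abs2_ge0.
have : 1 <= (M * Num.sqrt a) ^+ 2.
  by rewrite -(expr1n _ 2) lerXn2r ?nnegrE ?mulr_ge0 ?sqrtr_ge0 ?(ltW M0)// ler01.
rewrite exprMn sqr_sqrtr// => {}h.
by rewrite -[leLHS]mul1r ler_pdivrMr ?exprn_gt0// mulrC.
Qed.

(** The operator is the square of the self-adjoint diagonal operator [S] with entries
    [Num.sqrt (r n)], so the form at [x] is the squared norm of [S x]. *)
Lemma diag_real_positive (r : nat -> R) (M : R) : (forall n, 0 <= r n <= M) ->
  positive_op (diagop (fun n => (r n)%:C)).
Proof.
move=> rM x.
have M0 : 0 <= M by case/andP: (rM 0%N); exact: le_trans.
have br : bounded_sequence (fun n => (r n)%:C).
  by exists (M ^+ 2) => n; rewrite abs2_real lerXn2r ?nnegrE//; case/andP: (rM n).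
have bs : bounded_sequence (fun n => (Num.sqrt (r n))%:C).
  by exists M => n; rewrite abs2_real; case/andP: (rM n) => r0 ?; rewrite sqr_sqrtr.
have -> : diagop (fun n => (r n)%:C) x =
    diag (fun n => (Num.sqrt (r n))%:C) (diag (fun n => (Num.sqrt (r n))%:C) x).
  apply: ell2_eq => n; rewrite /= !diagE// mulrA -rmorphM /= -expr2 sqr_sqrtr//.
  by case/andP: (rM n).
rewrite /= diag_adjoint//.
have -> : (fun n => ((Num.sqrt (r n))%:C)^*) = (fun n => (Num.sqrt (r n))%:C).
  by apply/funext => n; exact: conjc_real.
by rewrite ell2_dotE exprn_ge0.
Qed.

End Diagonal.

(** * Continuity of powers and difference quotients *)

Section RealFunctions.
Context {R : realType}.
Local Open Scope complex_scope.

Lemma ltc_norm (z : R[i]) (e : R) : 0 < e -> (`|z| < e%:C) = (abs2 z < e ^+ 2).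
Proof.
move=> e0; rewrite normc_def ltcR -/(abs2 z) -{1}(ger0_norm (ltW e0)) -sqrtr_sqr.
by rewrite ltr_sqrt ?exprn_gt0.
Qed.

Lemma continuous_Re : continuous (@complex.Re R : R[i]^o -> R).
Proof.
move=> z P /nbhs_ballP[e /= e0 eP]; apply/nbhs_ballP; exists e%:C; rewrite /= ?ltcR//.
move=> w; rewrite /ball /= ltc_norm// => zw; apply: eP; rewrite /ball /=.
rewrite -ReB -(@ltr_pXn2r _ 2) ?nnegrE ?(ltW e0)// real_normK ?num_real//.
by apply: le_lt_trans zw; rewrite lerDl sqr_ge0.
Qed.

Lemma continuous_Im : continuous (@complex.Im R : R[i]^o -> R).
Proof.
move=> z P /nbhs_ballP[e /= e0 eP]; apply/nbhs_ballP; exists e%:C; rewrite /= ?ltcR//.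
move=> w; rewrite /ball /= ltc_norm// => zw; apply: eP; rewrite /ball /=.
rewrite -ImB -(@ltr_pXn2r _ 2) ?nnegrE ?(ltW e0)// real_normK ?num_real//.
by apply: le_lt_trans zw; rewrite lerDr sqr_ge0.
Qed.

Lemma continuous_abs2 : continuous (abs2 : R[i]^o -> R).
Proof.
move=> z; have FF : Filter (nbhs (z : R[i]^o)) by exact: nbhs_filter.
by apply: cvgD; apply: cvgM; do ?exact: continuous_Re; exact: continuous_Im.
Qed.

Lemma continuous_real_complex : continuous ((fun x => x%:C) : R -> R[i]^o).
Proof.
move=> x P /nbhs_ballP[e /= /gtc0_real[e0 eE] eP]; apply/nbhs_ballP; exists (Re e) => //.
move=> y; rewrite /ball /= => xy; apply: eP.
rewrite /ball /= eE -rmorphB ltc_norm// abs2_real.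
by rewrite -real_normK ?num_real// ltr_pXn2r ?nnegrE// ltW.
Qed.

(** The absolute value gives a function continuous on the whole line that agrees with the power on
    the spectrum, where the real part is nonnegative. *)
Lemma continuous_normr_powR (t : R) : 0 < t -> continuous (fun x : R => `|x| `^ t).
Proof.
move=> t0 x; have [->|x0] := eqVneq x 0; last first.
  have xx : `|y| @[y --> x] --> `|x| by exact: norm_continuous.
  apply: (cvg_comp _ (fun y : R => y `^ t) xx).
  suff : {for `|x|, continuous (fun y : R => y `^ t)} by exact.
  apply/differentiable_continuous/derivable1_diffP; apply: derivable_powR.
  by rewrite in_itv/= andbT normr_gt0.
rewrite /continuous_at normr0 powR0 ?gt_eqF//; apply/cvgrPdist_lt => e e0.
exists (e `^ t^-1) => [|y] /=; rewrite ?powR_gt0// /ball_ /= !sub0r !normrN.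
rewrite (@ger0_norm _ (_ `^ _)) ?powR_ge0// => ye.
have -> : e = (e `^ t^-1) `^ t by rewrite -powRrM mulVf ?gt_eqF// powRr1// ltW.
by apply: gt0_ltr_powR => //; rewrite nnegrE ?powR_ge0.
Qed.

(* Caratheodory's form of differentiability at [l]. *)
Lemma derivable_slope (f : R -> R) (l : R) : continuous f -> derivable f l 1 ->
  exists2 g : R -> R, continuous g & forall x, f x - f l = g x * (x - l).
Proof.
move=> fc fl; pose g x := if x == l then 'D_1 f l else (f x - f l) / (x - l).
exists g; last first.
  move=> x; rewrite /g; case: eqVneq => [->|xl]; first by rewrite !subrr mulr0.
  by rewrite divfK// subr_eq0.
move=> x; have [->|xl] := eqVneq x l; last first.
  have gx : \forall y \near x, (f y - f l) / (y - l) = g y.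
    have : \forall y \near x, y != l.
      exists `|x - l| => [|y] /=; first by rewrite normr_gt0 subr_eq0.
      by apply: contraTneq => ->; rewrite /ball_ /= ltxx.
    by apply: filterS => y yl; rewrite /g (negbTE yl).
  have gxE : g x = (f x - f l) / (x - l) by rewrite /g (negbTE xl).
  rewrite /continuous_at gxE; apply: cvg_trans (near_eq_cvg gx) _.
  apply: cvgM; first by apply: cvgB; [exact: fc|exact: cvg_cst].
  by apply: cvgV; [rewrite subr_eq0|apply: cvgB; [exact: cvg_id|exact: cvg_cst]].
have glE : g l = 'D_1 f l by rewrite /g eqxx.
rewrite /continuous_at glE; apply/cvgrPdist_lt => e e0.
have /cvgrPdist_lt /(_ e e0) [d /= d0 dP] :
    h^-1 *: (f (h *: (1 : R) + l) - f l) @[h --> 0^'] --> 'D_1 f l.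
  exact: fl.
exists d => // y /= yd; rewrite /g; case: eqVneq => [_|yl]; first by rewrite subrr normr0.
have := dP (y - l); rewrite /ball_ /= sub0r opprB => /(_ yd).
rewrite subr_eq0 => /(_ yl).
rewrite /(_ *: _) /= mulr1 subrK mulrC; exact.
Qed.

End RealFunctions.

(** * Functional calculus of diagonal operators with entries in [[0, 1]] *)

Section Calculus.
Context {R : realType}.
Local Open Scope complex_scope.
Local Notation ell2 := (@ell2 R).
Local Notation H := (@ell2_hilbert R).

Lemma real_complexB (z : R[i]) (a : R) : z = (Re z)%:C -> z - a%:C = (Re z - a)%:C.
Proof. by case: z => b c [->]; rewrite rmorphB. Qed.

Section DiagonalCalculus.
Variable r : nat -> R.
Hypothesis r01 : forall n, 0 <= r n <= 1.
Let d n : R[i] := (r n)%:C.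
Let A : {linear H -> H} := diagop d.

Let d_bounded : bounded_sequence d.
Proof.
by exists 1 => n; rewrite abs2_real expr_le1//; case/andP: (r01 n).
Qed.

Lemma mem_spectrum n : spectrum A (d n).
Proof.
apply/spectrum_diagP => // e e0; exists n.
by rewrite subrr /abs2 /= expr0n addr0.
Qed.

Lemma spectrum_closure x : closure (range r) x -> spectrum A x%:C.
Proof.
move=> rx; apply/spectrum_diagP => // e e0.
have [|_ [[n _ <-]]] := rx (ball x (Num.sqrt e)).
  by apply: nbhsx_ballx; rewrite sqrtr_gt0.
rewrite -ball_normE /ball_ /= => xn; exists n.
rewrite -rmorphB abs2_real -real_normK ?num_real// distrC -[ltRHS]sqr_sqrtr ?(ltW e0)//.
by rewrite ltr_pXn2r ?nnegrE ?sqrtr_ge0.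
Qed.

Lemma spectrum_real z : spectrum A z -> z = (Re z)%:C /\ closure (range r) (Re z).
Proof.
move=> /spectrum_diagP -/(_ d_bounded) zd.
have abs2_d n : abs2 (d n - z) = (r n - Re z) ^+ 2 + Im z ^+ 2.
  by case: (z) => a b; rewrite /abs2 /= sub0r sqrrN.
split.
  apply/eqP; rewrite eq_complex /= eqxx /=; apply/negP => /negP z0.
  have [|n] := zd (Im z ^+ 2); first by rewrite exprn_even_gt0.
  by rewrite abs2_d ltNge lerDr sqr_ge0.
move=> B /nbhs_ballP[e /= e0 eB].
have [|n] := zd (e ^+ 2); first by rewrite exprn_gt0.
rewrite abs2_d => rz; exists (r n); split; first by exists n.
apply: eB; rewrite -ball_normE /ball_ /= distrC.
rewrite -(@ltr_pXn2r _ 2) ?nnegrE ?(ltW e0)// real_normK ?num_real//.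
by apply: le_lt_trans rz; rewrite lerDl sqr_ge0.
Qed.

Let closure_sub (B : set R) :
  closed B -> range r `<=` B -> closure (range r) `<=` B.
Proof. by move=> /closure_id BE /closureS rB x /rB; rewrite -BE. Qed.

Let closure_range : closure (range r) `<=` `[0, 1].
Proof.
apply: closure_sub.
  exact: interval_closed.
by move=> _ [n _ <-]; rewrite /= in_itv /=; exact: r01.
Qed.

Lemma spectrum01 z : spectrum A z -> 0 <= Re z <= 1.
Proof. by move=> /spectrum_real[_ /closure_range] /=; rewrite in_itv. Qed.

(** The closure of the entries is compact in [[0, 1]], so [f] is bounded there. Hence [diag] of the
    values [f (d n)] is the genuine diagonal operator and not its zero default. *)
Lemma bounded_on_spectrum (f : R[i] -> R[i]) : continuous_on_spectrum A f ->
  bounded_sequence (fun n => f (d n)).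
Proof.
move=> /subspace_continuousP fc.
have gc : {within closure (range r), continuous (fun x : R => abs2 (f x%:C))}.
  apply/subspace_continuousP => x rx.
  have fx := fc x%:C (spectrum_closure rx).
  have fxr : f y%:C @[y --> within (closure (range r)) (nbhs x)] --> (f x%:C : R[i]^o).
    move=> P /fx PA.
    apply: (@filterS _ (nbhs x) _ _ _ _ (continuous_real_complex PA)).
    by move=> y /= yP ry; apply: yP; exact: spectrum_closure.
  exact: (cvg_comp _ _ fxr (@continuous_abs2 R _)).
have K : compact (closure (range r)).
  apply: subclosed_compact closure_range; first exact: closed_closure.
  exact: segment_compact.
have /compact_bounded[M [_ /(_ (M + 1))]] := continuous_compact gc K.
rewrite ltrDl ltr01 => /(_ isT) fM; exists (M + 1) => n.
have := fM (abs2 (f (d n))); rewrite /= ger0_norm ?abs2_ge0//; apply.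
by exists (r n) => //; apply: subset_closure; exists n.
Qed.

(** Existence of one calculus ensures that [functional_calculus] is an actual calculus and not the
    default value of [xget]. *)
Lemma diag_functional_calculus :
  is_functional_calculus A (fun f => diag (fun n => f (d n)) : H -> H).
Proof.
split.
- by move=> f _; exact: diag_linear.
- by move=> f _; exact: diag_continuous.
- move=> f g _ _ fg; congr diag; apply/funext => n; apply: fg.
  by apply/mem_set; exact: mem_spectrum.
- apply/funext => u; apply: ell2_eq => n; rewrite diagE ?mul1r//.
  by exists 1 => k; rewrite abs2_real expr1n.
- by [].
- move=> f g /bounded_on_spectrum fb /bounded_on_spectrum gb u; apply: ell2_eq => n.
  transitivity (diag (fun n => f (d n)) u n + diag (fun n => g (d n)) u n) => //.
  rewrite !diagE// ?mulrDl//.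
  have [[M fM] [N gN]] := (fb, gb).
  exists ((1 + 1) * M + (1 + 1) * N) => k.
  apply: le_trans (abs2D_le _ _ ltr01) _; rewrite invr1.
  by apply: lerD; rewrite ler_pM2l ?addr_gt0.
- move=> c f /bounded_on_spectrum fb u; apply: ell2_eq => n.
  transitivity (c * diag (fun n => f (d n)) u n) => //.
  rewrite !diagE ?mulrA//.
  by have [M fM] := fb; exists (abs2 c * M) => k; rewrite abs2M ler_wpM2l ?abs2_ge0.
- move=> f g /bounded_on_spectrum fb /bounded_on_spectrum gb u; apply: ell2_eq => n.
  rewrite !diagE ?mulrA//.
  have [[M fM] [N gN]] := (fb, gb); exists (M * N) => k.
  by rewrite abs2M; apply: ler_pM; rewrite ?abs2_ge0.
- by move=> f /bounded_on_spectrum fb x y; exact: diag_adjoint.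
Qed.

Lemma continuous_on_spectrum_real (p : R -> R) (f : R[i] -> R[i]) :
  continuous p -> (forall z, spectrum A z -> f z = (p (Re z))%:C) ->
  continuous_on_spectrum A f.
Proof.
move=> pc fp; rewrite /continuous_on_spectrum.
apply: (@subspace_eq_continuous _ _ _
  ((fun z => (p (Re z))%:C) : R[i]^o -> R[i]^o)).
  by move=> z /set_mem Az; apply/esym; exact: fp.
apply: continuous_subspaceT => z.
have Rz := @continuous_Re R z.
have pz := cvg_comp _ _ Rz (pc (Re z)).
exact: (cvg_comp _ _ pz (@continuous_real_complex R _)).
Qed.

Lemma continuous_on_spectrum_cst (c : R[i]) : continuous_on_spectrum A (fun=> c).
Proof.
apply: continuous_subspaceT => z.
have FF : Filter (nbhs (z : R[i]^o)) by exact: nbhs_filter.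
exact: cvg_cst.
Qed.

(* [h] is the difference quotient of [f] at the eigenvalue, so that
   [Phi f - f (d k) = Phi h (A - d k)] kills the eigenvector. *)
Lemma fcalc_eigen Phi (f h : R[i] -> R[i]) k : is_functional_calculus A Phi ->
  continuous_on_spectrum A f -> continuous_on_spectrum A h ->
  (forall z, spectrum A z -> f z - f (d k) = h z * (z - d k)) ->
  Phi f (ell2_basis k) = f (d k) *: (ell2_basis k : H).
Proof.
move=> [PL _ Pext P1 Pid PD PZ PM _] fc hc fh.
(* Constants are written as multiples of [cst 1], the form that [fcalcZ] and [fcalc1] evaluate. *)
have cc (c : R[i]) : continuous_on_spectrum A (fun z => c * cst 1 z).
  exact: (@continuous_on_spectrum_cst (c * 1)).
have idc : continuous_on_spectrum A id.
  apply: (@continuous_on_spectrum_real id); first by move=> x; exact: cvg_id.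
  by move=> z /spectrum_real[].
have Pc (c : R[i]) x : Phi (fun z => c * cst 1 z) x = c *: x.
  by rewrite (PZ c (cst 1) (@continuous_on_spectrum_cst 1) x) P1.
have ic : continuous_on_spectrum A (id \+ (fun z => - d k * cst 1 z)).
  apply: (@continuous_on_spectrum_real (fun x => x - r k)).
    by move=> x; apply: cvgB; [exact: cvg_id|exact: cvg_cst].
  move=> z /spectrum_real [zE _].
  by transitivity (z - d k); [rewrite /= mulr1|exact: real_complexB].
pose g := (h \* (id \+ (fun z => - d k * cst 1 z))) \+ (fun z => f (d k) * cst 1 z).
have fg : {in spectrum A, f =1 g}.
  by move=> z /set_mem /fh; rewrite /g /= !mulr1 => <-; rewrite subrK.
(* On the spectrum this product equals [f z - f (d k)], from which its continuity is read off. *)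
have hic : continuous_on_spectrum A (h \* (id \+ (fun z => - d k * cst 1 z))).
  rewrite /continuous_on_spectrum.
  apply: (@subspace_eq_continuous _ _ _ ((fun z => f z - f (d k)) : R[i]^o -> R[i]^o)).
    by move=> z /set_mem Az; rewrite /= mulr1; exact: fh.
  move: fc => /subspace_continuousP fc; apply/subspace_continuousP => z Az.
  by apply: cvgB; [exact: fc|exact: cvg_cst].
have gc : continuous_on_spectrum A g.
  by apply: subspace_eq_continuous fc.
have gE x : Phi g x = Phi h (A x + - d k *: x) + f (d k) *: x.
  apply: etrans (PD _ _ hic (cc (f (d k))) x) _; congr (_ + _); last exact: Pc.
  apply: etrans (PM _ _ hc ic x) _; congr (Phi h _).
  by apply: etrans (PD _ _ idc (cc (- d k)) x) _; rewrite Pid; congr (_ + _); exact: Pc.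
have Ak : A (ell2_basis k) + - d k *: (ell2_basis k : H) = 0.
  by rewrite -[A _]/(diag d (ell2_basis k)) diag_basis// -scalerDl subrr scale0r.
have Ph0 : Phi h 0 = 0.
  by have := PL h hc (-1) 0 0; rewrite scaler0 addr0 scaleN1r addNr.
by rewrite (Pext f g fc gc fg) gE Ak Ph0 add0r.
Qed.

(** The adjoint rule moves the calculus onto a basis vector, where [fcalc_eigen] evaluates it. For
    [t < 1] the difference quotient of the power at 0 is unbounded near 0, hence the entry is
    positive, or else all entries vanish and the spectrum reduces to 0. *)
Lemma oppow_diag (t : R) (u : ell2) n : 0 <= t ->
  (0 < r n \/ forall k, r k = 0) -> (oppow A t u : ell2) n = (r n `^ t)%:C * u n.
Proof.
move=> t0 rn; rewrite /oppow; have [->|tN0] := eqVneq t 0.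
  by rewrite powRr0 mul1r.
have {}t0 : 0 < t by rewrite lt_def tN0.
pose f (z : R[i]) := (Re z `^ t)%:C.
have fE z : spectrum A z -> f z = (`|Re z| `^ t)%:C.
  by move=> /spectrum01/andP[z0 _]; rewrite ger0_norm.
have fc : continuous_on_spectrum A f.
  exact: (continuous_on_spectrum_real (continuous_normr_powR t0) fE).
have [h hc fh] : exists2 h : R[i] -> R[i], continuous_on_spectrum A h &
    forall z, spectrum A z -> f z - f (d n) = h z * (z - d n).
  case: rn => [rn0|r0].
    have near_eq : {near r n, (fun x : R => x `^ t) =1 (fun x : R => `|x| `^ t)}.
      exists (r n) => //= y; rewrite /ball_ /= => yr.
      by rewrite gtr0_norm//; move: yr; rewrite ltr_norml => /andP[_]; lra.
    have der : derivable (fun x : R => `|x| `^ t) (r n) 1.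
      have dp : derivable (fun x : R => x `^ t) (r n) 1.
        by apply: derivable_powR; rewrite in_itv/= andbT.
      exact: (near_eq_derivable near_eq dp).
    have [g gc gE] := derivable_slope (continuous_normr_powR t0) der.
    exists (fun z => (g (Re z))%:C); first exact: continuous_on_spectrum_real.
    move=> z Az; rewrite !fE//; last exact: mem_spectrum.
    have [zE _] := spectrum_real Az.
    have -> : z - d n = (Re z - r n)%:C by exact: real_complexB.
    by rewrite -rmorphB gE rmorphM.
  (* All entries vanish, so [f] is constant on the spectrum and the quotient 0 works. *)
  exists (cst 0); first exact: continuous_on_spectrum_cst.
  move=> z /spectrum_real[zE rz]; rewrite mul0r /f /d /= r0.
  have -> : Re z = 0.
    have r1 : range r `<=` `[0, 0] by move=> _ [k _ <-]; rewrite /= r0 in_itv /= lexx.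
    have cl0 : closed (`[0, 0] : set R) by exact: interval_closed.
    have := closure_sub cl0 r1 rz.
    by rewrite /= in_itv /= => /le_anti.
  by rewrite subrr.
rewrite /functional_calculus.
(* [Phi] is some calculus, not known to be the diagonal one; its axioms alone determine the
   coordinate. *)
case: xgetP => [Phi _ PhiP|/(_ _ diag_functional_calculus)//].
rewrite -/f -ell2_dot_basis.
have Padj := fcalc_adjoint PhiP fc u (ell2_basis n).
rewrite -[LHS]/(inner H (Phi f u) (ell2_basis n)) Padj.
have -> : (fun z => (f z)^*) = f by apply/funext => z; exact: conjc_real.
rewrite (fcalc_eigen PhiP fc hc fh).
rewrite -[LHS]/(ell2_dot u (f (d n) *: ell2_basis n)) linearZr_LR /=.
by rewrite ell2_dot_basis; congr (_ * _); exact: conjc_real.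
Qed.

End DiagonalCalculus.
End Calculus.

(** * Observability of diagonal systems *)

Section Observability.
Context {R : realType}.
Local Open Scope complex_scope.
Local Notation ell2 := (@ell2 R).
Local Notation H := (@ell2_hilbert R).

Lemma eseries_EFin (f : nat -> R) (l : R) : series f @ \oo --> l ->
  (\sum_(n <oo) (f n)%:E = l%:E)%E.
Proof.
move=> fl; apply: cvg_lim => //.
rewrite (_ : (fun n => _) = EFin \o series f); first exact: cvg_comp fl _.
by apply/funext => n; rewrite /= sumEFin.
Qed.

Lemma sqnorm_eseries (u : ell2) : (\sum_(k <oo) (abs2 (u k))%:E = (sqnorm u)%:E)%E.
Proof. by apply: eseries_EFin; exact/square_summableP/ell2P. Qed.

Lemma esumZ (I : choiceType) (D : set I) (f : I -> R) (c : R) :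
  0 < c -> (\esum_(i in D) (c * f i)%:E = c%:E * \esum_(i in D) (f i)%:E)%E.
Proof.
move=> c0; apply/eqP; rewrite eq_le -lee_pdivlMl//; apply/andP; split.
  apply: ge_ereal_sup => _ [X [finX XD] <-].
  rewrite fsbig_finite//= sumEFin -mulr_sumr EFinM lee_wpmul2l//.
    by rewrite lee_fin ltW.
  by apply: fset_sum_le_esum => i /=; rewrite in_fset_set// inE => /XD.
apply: ge_ereal_sup => _ [X [finX XD] <-].
rewrite fsbig_finite//= sumEFin lee_pdivlMl// -EFinM mulr_sumr.
by apply: fset_sum_le_esum => i /=; rewrite in_fset_set// inE => /XD.
Qed.

Lemma normsq_ell2 (u : H) : normsq u = sqnorm u.
Proof. by rewrite /normsq ell2_norm_sqr. Qed.

Section WeightedDiagonal.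
Variable r : nat -> R.
Hypothesis r01 : forall n, 0 <= r n < 1.
Hypothesis r0 : (forall n, 0 < r n) \/ (forall n, r n = 0).

Let r_le1 n : 0 <= r n <= 1.
Proof. by case/andP: (r01 n) => -> /ltW. Qed.

Let weight n : R := 1 - r n ^+ 2.

Let weight_gt0 n : 0 < weight n.
Proof. by have /andP[rn0 rn1] := r01 n; rewrite subr_gt0 exprn_ilt1. Qed.

Let weight_bounded : bounded_sequence (fun n => (Num.sqrt (weight n))%:C).
Proof.
by exists 1 => n; rewrite abs2_real sqr_sqrtr ?(ltW (weight_gt0 n))// gerBl sqr_ge0.
Qed.

Let A : {linear H -> H} := diagop (fun n => (r n)%:C).
Let C : {linear H -> H} := diagop (fun n => (Num.sqrt (weight n))%:C).

Let observation (t : R) (u : ell2) n : 0 <= t ->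
  (C (oppow A t u) : ell2) n = (Num.sqrt (weight n) * r n `^ t)%:C * u n.
Proof.
move=> t0; transitivity ((Num.sqrt (weight n))%:C * (oppow A t u : ell2) n).
  exact: diagE.
rewrite oppow_diag ?rmorphM ?mulrA//.
by case: r0 => ?; [left|right].
Qed.

Let abs2_observation (t : R) (u : ell2) n : 0 <= t ->
  abs2 ((C (oppow A t u) : ell2) n) = weight n * (r n `^ t) ^+ 2 * abs2 (u n).
Proof.
move=> t0; rewrite observation// abs2M abs2_real exprMn sqr_sqrtr//.
exact: ltW.
Qed.

(* Exchange the sums: [(1 - r k ^+ 2) * \sum_n r k ^+ (2 * n) = 1] for every [k]. *)
Lemma weighted_diag_observable_nat :
  exactly_observable C A [set n%:R | n in [set: nat]].
Proof.
exists 1, 1; split => // u.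
suff -> : (\esum_(t in [set n%:R | n in [set: nat]])
    (normsq (C (oppow A t u)))%:E = (normsq u)%:E)%E by rewrite mul1r lexx.
rewrite esum_image; last by move=> m n _ _ /(@mulrIn R 1) -> //; rewrite oner_eq0.
rewrite -nneseries_esumT; last by move=> n; rewrite normsq_ell2 lee_fin sqnorm_ge0.
transitivity (\sum_(n <oo) \sum_(k <oo) (weight k * (r k ^+ 2) ^+ n * abs2 (u k))%:E)%E.
  apply: eq_eseriesr => n _; rewrite normsq_ell2 -sqnorm_eseries.
  apply: eq_eseriesr => k _; rewrite abs2_observation//.
  by rewrite powR_mulrn -?exprM 1?mulnC//; case/andP: (r01 k).
rewrite nneseries_interchange; last first.
  move=> n k; rewrite lee_fin mulr_ge0 ?abs2_ge0// mulr_ge0 ?exprn_ge0 ?sqr_ge0//.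
    exact: ltW.
  by case/andP: (r01 k).
rewrite normsq_ell2 -sqnorm_eseries; apply: eq_eseriesr => k _.
apply: eseries_EFin.
have rk : `|r k ^+ 2| < 1.
  by rewrite ger0_norm ?sqr_ge0// exprn_ilt1//; case/andP: (r01 k).
have := @cvg_geometric_series R (weight k * abs2 (u k)) _ rk.
rewrite mulrAC mulfV ?mul1r ?lt0r_neq0 ?weight_gt0//.
rewrite (_ : geometric _ _ = (fun n => weight k * r k ^+ 2 ^+ n * abs2 (u k)))//.
by apply/funext => n /=; rewrite mulrAC.
Qed.

(** Evaluate observability along [T] at the unit basis vectors; its constants are the same for every
    [n]. *)
Lemma universal_weighted_bound (T : set R) : universal_time_set T ->
  exists a b : R, 0 < a /\ forall n,
    (a%:E <= \esum_(t in T) (weight n * (r n `^ t) ^+ 2)%:E <= b%:E)%E.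
Proof.
move=> [T0 _ uT].
have [a [b [a0 _ abT]]] := uT H H A C ell2_separable ell2_separable
  (@diag_continuous R _) (diag_real_positive r_le1) (@diag_continuous R _)
  weighted_diag_observable_nat.
exists a, b; split => // n; have := abT (ell2_basis n).
rewrite normsq_ell2 sqnorm_basis !mulr1.
rewrite (eq_esum (b := fun t => (weight n * (r n `^ t) ^+ 2)%:E))//.
move=> t /T0 /= t0; congr _%:E.
rewrite normsq_ell2.
have -> : C (oppow A t (ell2_basis n)) =
    (Num.sqrt (weight n) * r n `^ t)%:C *: ell2_basis n.
  apply: ell2_eq => k; rewrite observation//.
  transitivity ((Num.sqrt (weight n) * r n `^ t)%:C * ell2_basis n k) => //.
  by rewrite ell2_basisE; case: eqVneq => [->|]; rewrite ?mulr0.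
rewrite sqnormZ sqnorm_basis mulr1 abs2_real exprMn sqr_sqrtr//.
exact: ltW.
Qed.

End WeightedDiagonal.

(** Take all entries 0: then [oppow A t] vanishes for [t != 0], and without the time 0 the sum would
    be 0, below [a]. *)
Lemma universal_mem0 (T : set R) : universal_time_set T -> T 0.
Proof.
move=> uT; have [|a [b [a0 /(_ 0%N)/andP[aT _]]]] :=
    @universal_weighted_bound (fun=> 0) _ (or_intror (fun=> erefl)) T uT.
  by move=> _; rewrite lexx ltr01.
apply: contrapT => T0; move: aT; rewrite esum1 ?lee_fin ?leNgt ?a0// => t Tt.
by rewrite powR0 ?expr0n ?mulr0//; apply: contra_notN T0 => /eqP <-.
Qed.

Lemma universal_F_bounded (T : set R) : universal_time_set T -> F_bounded T.
Proof.
move=> uT; apply: contrapT => TF.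
have /choice[r rP] : forall k : nat, exists x : R, 0 < x < 1 /\
    ~ (((k.+1%:R)^-1)%:E <= F_ T x <= k.+1%:R%:E)%E.
  move=> k; apply: contrapT => /forallNP h; apply: TF.
  exists k.+1%:R^-1, k.+1%:R; split; first by rewrite invr_gt0.
    by apply: (@le_trans _ _ 1); rewrite ?invf_le1 ?ler1n.
  by move=> r r01; apply: contrapT => rF; apply: (h r).
have [||a [b [a0 ab]]] := @universal_weighted_bound r _ _ T uT.
- by move=> k; have [/andP[/ltW -> ->]] := rP k.
- by left => k; have [/andP[]] := rP k.
(* This index exceeds both [a^-1] and [b], so the uniform bounds place [F_ T (r k)] between
   [k.+1%:R^-1] and [k.+1%:R]. *)
pose k := Num.bound (a^-1 + `|b|).
have kP : a^-1 + `|b| < k%:R.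
  by apply: archi_boundP; rewrite addr_ge0// invr_ge0 ltW.
have [/andP[rk0 rk1] []] := rP k.
have -> : F_ T (r k) = (\esum_(t in T) ((1 - r k ^+ 2) * (r k `^ t) ^+ 2)%:E)%E.
  rewrite /F_ -esumZ; last by rewrite subr_gt0 exprn_ilt1// ltW.
  apply: eq_esum => t _; congr (_ * _)%:E.
  by rewrite -powR_mulrn ?powR_ge0// -powRrM mulrC.
have /andP[aF Fb] := ab k; apply/andP; split.
  apply: le_trans aF; rewrite lee_fin -[leRHS]invrK lef_pV2 ?posrE ?invr_gt0//.
  by have := normr_ge0 b; rewrite -natr1; lra.
apply: le_trans Fb _; rewrite lee_fin -natr1.
have := ler_norm b; have : 0 < a^-1 by rewrite invr_gt0.
lra.
Qed.

End Observability.

Theorem theorem3p1 (R : realType) (T : set R)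
    (T_ge0 : T `<=` [set t | 0 <= t]) (T_lf : locally_finite T) :
  (universal_time_set T -> T 0 /\ F_bounded T) /\
  (T 0 -> (F_bounded T <-> linear_growth T)).
Proof.
split=> [uT|T0]; first by split; [exact: universal_mem0|exact: universal_F_bounded].
split; first exact: F_bounded_linear_growth.
exact: linear_growth_F_bounded.
Qed.
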